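(* Let $\varphi(z)=\left(1+\frac{z}{2}\right)^2=1+z+\frac{z^2}{4}$ and let $f(z)=z+\sum_{n=2}^{\infty}a_nz^n$ belong to the class $\mathcal{C}(\varphi)$. Then the second Hankel determinant $H_2(2)=a_2a_4-a_3^2$ of $f$ satisfies $$|H_2(2)|\le \frac{1}{36}.$$ The estimate is sharp, i.e. there exists a function in $\mathcal{C}(\varphi)$ for which equality holds.
   Context: $\mathbb{D}=\{z\in\mathbb{C}:|z|<1\}$ is the unit disk. $\mathcal{A}$ is the class of analytic functions $f$ in $\mathbb{D}$ with $f(0)=0$ and $f'(0)=1$, so $f(z)=z+\sum_{n=2}^\infty a_nz^n$. For analytic functions $g,h$ in $\mathbb{D}$, $g\prec h$ ($g$ is subordinate to $h$) means that there is an analytic function $\omega:\mathbb{D}\to\mathbb{D}$ with $\omega(0)=0$ such that $g(z)=h(\omega(z))$ for all $z\in\mathbb{D}$. With $\varphi(z)=(1+z/2)^2$, the class $\mathcal{C}(\varphi)$ consists of all $f\in\mathcal{A}$ such that $1+\frac{zf''(z)}{f'(z)}\prec\varphi(z)$ in $\mathbb{D}$ (in particular $f'(z)\ne 0$ in $\mathbb{D}$). *)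

(* Defs.v *)
(* Stdlib reals with Coquelicot's complex numbers. *)
From Stdlib Require Import Reals.
From Coquelicot Require Import Coquelicot.
Open Scope R_scope.
Open Scope C_scope.

Definition unit_disk (z : C) : Prop := (Cmod z < 1)%R.

(* Functions on the disk are represented by total functions [C -> C]. All the
   notions below only depend on their values in the (open) disk. *)

(* Complex differentiability at every point of the disk. *)
Definition analytic_in_disk (f : C -> C) : Prop :=
  forall z : C, unit_disk z -> @ex_derive C_AbsRing C_NormedModule f z.

Definition class_A (f : C -> C) : Prop :=
  analytic_in_disk f /\ f 0 = 0 /\ C_derive f 0 = 1.

Definition subordinate (g h : C -> C) : Prop :=
  exists omega : C -> C,
    analytic_in_disk omega /\
    (forall z : C, unit_disk z -> unit_disk (omega z)) /\
    omega 0 = 0 /\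
    (forall z : C, unit_disk z -> g z = h (omega z)).

(* Division is total in Coquelicot, so the requirement that [f'] has no zero,
   implicit in the quotient [z f''/f'] being defined, is stated explicitly. *)
Definition class_C (phi f : C -> C) : Prop :=
  class_A f /\
  (forall z : C, unit_disk z -> C_derive f z <> 0) /\
  subordinate (fun z => 1 + z * C_derive (C_derive f) z / C_derive f z) phi.

Definition phi (z : C) : C := (1 + z / 2) ^ 2.

(* f(z) = z + sum_{n >= 2} a_n z^n in the disk; the values [a 0] and [a 1] are
   irrelevant. *)
Definition has_expansion (f : C -> C) (a : nat -> C) : Prop :=
  forall z : C, unit_disk z ->
    @is_series C_AbsRing C_NormedModule
      (fun k : nat => a (k + 2)%nat * z ^ (k + 2)) (f z - z).

Definition hankel_2_2 (a : nat -> C) : C := a 2%nat * a 4%nat - a 3%nat ^ 2.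

(* Main.v *)
Require Import Defs.
From Stdlib Require Import Reals Lra Lia IndefiniteDescription.
From Coquelicot Require Import Coquelicot.
Open Scope R_scope.
Open Scope C_scope.

(** Write the subordinating function as [omega = c1 z + c2 z^2 + c3 z^3 + ...].
    Comparing Taylor coefficients in [z f'' = f' (omega + omega^2 / 4)] gives
    [72 H_2(2) = 3 c1 c3 + c1^2 c2 - c1^4 / 2 - 2 c2^2].
    Since [|omega| < 1], comparing the [L^2] norms of [omega p] and [p] on circles,
    for [p] of degree at most 2, shows that the lower triangular Toeplitz matrix of
    [c1, c2, c3] is a contraction. With [D = 1 - |c1|^2] this gives [|c2| <= D] and
    [|D c3 + conj c1 c2^2| <= D^2 - |c2|^2], from which [|72 H_2(2)| <= 2].

    Only one fact of complex integration is needed: the mean of [Re F] over circles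
    about [0] does not depend on the radius when [F'] is continuous. This continuity
    holds for [omega] because [f] is a power series and [(1 + omega / 2)^2] is
    rational in [z], [f'], [f'']. Equality holds for [omega z = z^2]. *)

(** The subordinating function is only assumed complex differentiable: neither a Taylor series nor
    Cauchy's formula comes with it. Its coefficients are therefore defined from those of [f], and
    the quadratic equation linking [omega] to [f] is solved with a remainder that is bounded near
    [0]; this finite expansion is all that the norm comparison uses. The comparison itself needs no
    inner products of series. On a circle about [0] conjugation is [z -> r^2 / z], so the
    non-constant part of the integrand becomes the real part of a function that is holomorphic off
    [0] and tends to [0] there. Polynomials of degree at most 2 are enough since the matrix acts on
    three coordinates. The constant is [2 / 72]: at [c1 = 0] the functional is [-2 c2^2], of modulus
    2 exactly when [|c2| = 1], which singles out [z^2] up to rotation. *)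

Notation Cfield := (AbsRing_NormedModule C_AbsRing).

(** * Complex differentiability and continuity in epsilon form *)

Definition cderiv (F : C -> C) (z l : C) : Prop := @is_derive C_AbsRing Cfield F z l.

Definition ccont (F : C -> C) (z : C) : Prop := @continuous Cfield Cfield F z.

(** Both module structures on the codomain have norm [Cmod], so the two derivatives agree by
    conversion. The right-hand one is the form in which product and chain rules apply. *)
Lemma cderiv_C_NormedModule (F : C -> C) (z l : C) :
  @is_derive C_AbsRing C_NormedModule F z l <-> cderiv F z l.
Proof.
  split; intros [_ H]; (split; [apply is_linear_scal_l|]); intros x Hx e; exact (H x Hx e).
Qed.

Lemma locally_cball (z : C) (P : C -> Prop) :
  @locally Cfield z P <-> exists d : posreal, forall w, (Cmod (w - z) < d)%R -> P w.
Proof.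
  split; intros [d H]; exists d; intros w Hw; apply H; exact Hw.
Qed.

Lemma cderiv_eps (F : C -> C) (z l : C) :
  cderiv F z l <->
  (forall eps : posreal, exists d : posreal, forall w, (Cmod (w - z) < d)%R ->
     (Cmod (F w - F z - l * (w - z)) <= eps * Cmod (w - z))%R).
Proof.
  split.
  - intros [_ H] eps.
    specialize (H z (fun P HP => HP) eps).
    apply locally_cball in H. destruct H as [d H]. exists d. intros w Hw.
    specialize (H w Hw).
    replace (l * (w - z)) with ((w - z) * l) by ring. exact H.
  - intros H. split; [apply is_linear_scal_l|].
    intros x Hx eps.
    assert (E := @is_filter_lim_locally_unique _ Cfield z x Hx). subst x.
    apply locally_cball. destruct (H eps) as [d Hd]. exists d. intros w Hw.
    specialize (Hd w Hw).
    replace (l * (w - z)) with ((w - z) * l) in Hd by ring. exact Hd.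
Qed.

Lemma cderiv_cont (F : C -> C) (z l : C) : cderiv F z l -> ccont F z.
Proof.
  intros H. apply (@filterdiff_continuous C_AbsRing Cfield Cfield). eexists. exact H.
Qed.

Lemma ccont_eps (F : C -> C) (z : C) :
  ccont F z <->
  (forall eps : posreal, exists d : posreal, forall w, (Cmod (w - z) < d)%R ->
     (Cmod (F w - F z) < eps)%R).
Proof.
  split.
  - intros H eps.
    assert (L : @locally Cfield z (fun w => @ball Cfield (F z) eps (F w))).
    { apply (H (@ball Cfield (F z) eps)). apply (@locally_ball Cfield). }
    apply locally_cball in L. exact L.
  - intros H P [eps HP]. apply locally_cball. destruct (H eps) as [d Hd].
    exists d. intros w Hw. apply HP. exact (Hd w Hw).
Qed.

Lemma cderiv_const (c z : C) : cderiv (fun _ => c) z 0.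
Proof. apply (@is_derive_const C_AbsRing Cfield). Qed.

Lemma cderiv_id (z : C) : cderiv (fun w => w) z 1.
Proof. apply (@is_derive_id C_AbsRing). Qed.

Lemma cderiv_plus (F G : C -> C) (z l m : C) :
  cderiv F z l -> cderiv G z m -> cderiv (fun w => F w + G w) z (l + m).
Proof. apply (@is_derive_plus C_AbsRing Cfield). Qed.

Lemma cderiv_minus (F G : C -> C) (z l m : C) :
  cderiv F z l -> cderiv G z m -> cderiv (fun w => F w - G w) z (l - m).
Proof. apply (@is_derive_minus C_AbsRing Cfield). Qed.

Lemma cderiv_mult (F G : C -> C) (z l m : C) :
  cderiv F z l -> cderiv G z m -> cderiv (fun w => F w * G w) z (l * G z + F z * m).
Proof. intros H K. apply (@is_derive_mult C_AbsRing F G z l m H K). exact Cmult_comm. Qed.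

Lemma cderiv_unique (F : C -> C) (z l m : C) : cderiv F z l -> cderiv F z m -> l = m.
Proof.
  rewrite !cderiv_eps. intros H K.
  destruct (Ceq_dec l m) as [E|N]; [exact E|exfalso].
  (* With this tolerance for each derivative, [l] and [m] would differ by at most half of
     [Cmod (l - m)]. *)
  assert (P : (0 < Cmod (l - m) / 4)%R).
  { assert (0 < Cmod (l - m))%R; [|lra]. apply Cmod_gt_0. intros E. apply N.
    replace l with (l - m + m) by ring. rewrite E. ring. }
  destruct (H (mkposreal _ P)) as [d1 H1]. destruct (K (mkposreal _ P)) as [d2 H2]. simpl in *.
  assert (P1 := cond_pos d1). assert (P2 := cond_pos d2).
  set (e := (Rmin d1 d2 / 2)%R).
  assert (Pe : (0 < Rmin d1 d2)%R) by now apply Rmin_pos.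
  assert (L1 := Rmin_l d1 d2). assert (L2 := Rmin_r d1 d2).
  assert (Me : Cmod (z + RtoC e - z) = e).
  { replace (z + RtoC e - z) with (RtoC e) by ring. rewrite Cmod_R. apply Rabs_pos_eq.
    unfold e; lra. }
  specialize (H1 (z + RtoC e)). specialize (H2 (z + RtoC e)). rewrite Me in *.
  assert (H1' := H1 ltac:(unfold e; lra)). assert (H2' := H2 ltac:(unfold e; lra)).
  assert (T := Cmod_triangle (F (z + RtoC e) - F z - m * (z + RtoC e - z))
     (- (F (z + RtoC e) - F z - l * (z + RtoC e - z)))).
  rewrite Cmod_opp in T.
  replace (F (z + RtoC e) - F z - m * (z + RtoC e - z) + - (F (z + RtoC e) - F z - l * (z + RtoC e - z)))
    with ((l - m) * RtoC e) in T by ring.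
  rewrite Cmod_mult, Cmod_R, Rabs_pos_eq in T by (unfold e; lra).
  assert (0 < e)%R by (unfold e; lra). nra.
Qed.

Lemma cderiv_ext (F G : C -> C) (z l m : C) :
  (forall w, F w = G w) -> l = m -> cderiv F z l -> cderiv G z m.
Proof. intros E <-. apply (@is_derive_ext C_AbsRing Cfield). exact E. Qed.

Lemma cderiv_inv_id (z : C) : z <> 0 -> cderiv Cinv z (- / (z * z)).
Proof.
  intros Hz. apply cderiv_eps. intros eps.
  assert (P := proj1 (Cmod_gt_0 z) Hz).
  set (m := Cmod z) in *.
  (* The first radius keeps [|w| >= m / 2]; the error is then at most [|w - z|^2 * 2 / m^3], which
     the second radius turns into [eps * |w - z|]. *)
  assert (Pd : (0 < Rmin (m / 2) (eps * m ^ 3 / 2))%R).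
  { apply Rmin_pos; [lra|].
    assert (0 < eps * m ^ 3)%R; [|lra]. apply Rmult_lt_0_compat; [apply eps|]. now apply pow_lt. }
  exists (mkposreal _ Pd). simpl. intros w Hw.
  assert (H1 := Rlt_le_trans _ _ _ Hw (Rmin_l _ _)).
  assert (H2 := Rlt_le_trans _ _ _ Hw (Rmin_r _ _)).
  assert (Hm : (m / 2 <= Cmod w)%R).
  { assert (T := Cmod_triangle w (- (w - z))). replace (w + - (w - z)) with z in T by ring.
    rewrite Cmod_opp in T. fold m in T. lra. }
  assert (Hw0 : w <> 0) by (apply Cmod_gt_0; lra).
  replace (/ w - / z - - / (z * z) * (w - z)) with ((w - z) * ((w - z) * (/ w * (/ z * / z)))).
  2: { field. auto. }
  rewrite !Cmod_mult, !Cmod_inv by auto. fold m.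
  rewrite Rmult_comm. apply Rmult_le_compat_r; [apply Cmod_ge_0|].
  apply Rle_trans with (eps * m ^ 3 / 2 * (/ (m / 2) * (/ m * / m)))%R.
  - assert (0 < / m)%R by now apply Rinv_0_lt_compat.
    apply Rmult_le_compat; [apply Cmod_ge_0| |lra|].
    + apply Rmult_le_pos; [left; apply Rinv_0_lt_compat; lra|nra].
    + apply Rmult_le_compat_r; [nra|]. apply Rinv_le_contravar; lra.
  - right. field. lra.
Qed.

Lemma cderiv_inv (F : C -> C) (z l : C) :
  cderiv F z l -> F z <> 0 -> cderiv (fun w => / F w) z (- l / (F z * F z)).
Proof.
  intros H N.
  assert (K := @is_derive_comp C_AbsRing Cfield Cinv F z _ _ (cderiv_inv_id _ N) H).
  refine (cderiv_ext _ _ _ _ _ (fun w => eq_refl) _ K).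
  change (l * (- / (F z * F z)) = - l / (F z * F z)). unfold Cdiv. ring.
Qed.

(** * Functions with a continuous complex derivative *)

(** Continuity of the derivative is built in because circle means are differentiated under the
    integral sign; this replaces Goursat's theorem. *)
Definition hol (U : C -> Prop) (F : C -> C) : Prop :=
  exists F', forall z, U z -> cderiv F z (F' z) /\ ccont F' z.

Lemma ccont_const (c z : C) : ccont (fun _ => c) z.
Proof. apply (@continuous_const Cfield Cfield). Qed.

Lemma ccont_plus (F G : C -> C) (z : C) :
  ccont F z -> ccont G z -> ccont (fun w => F w + G w) z.
Proof. apply (@continuous_plus Cfield C_AbsRing Cfield). Qed.

Lemma ccont_minus (F G : C -> C) (z : C) :
  ccont F z -> ccont G z -> ccont (fun w => F w - G w) z.
Proof. apply (@continuous_minus Cfield C_AbsRing Cfield). Qed.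

Lemma ccont_mult (F G : C -> C) (z : C) :
  ccont F z -> ccont G z -> ccont (fun w => F w * G w) z.
Proof. apply (@continuous_mult Cfield C_AbsRing). Qed.

Lemma ccont_inv (F : C -> C) (z : C) :
  ccont F z -> F z <> 0 -> ccont (fun w => / F w) z.
Proof.
  intros H N. apply (@continuous_comp Cfield Cfield Cfield F Cinv); [exact H|].
  exact (cderiv_cont _ _ _ (cderiv_inv_id _ N)).
Qed.

Ltac ccont_tac :=
  lazymatch goal with
  | |- ccont (fun _ => ?c) _ => apply ccont_const
  | |- ccont (fun z => Cplus (@?a z) (@?b z)) _ => apply (ccont_plus a b); ccont_tac
  | |- ccont (fun z => Cminus (@?a z) (@?b z)) _ => apply (ccont_minus a b); ccont_tac
  | |- ccont (fun z => Cmult (@?a z) (@?b z)) _ => apply (ccont_mult a b); ccont_tac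
  | |- _ => try assumption
  end.

Section Hol.
Variable U : C -> Prop.

Lemma hol_cont F z : hol U F -> U z -> ccont F z.
Proof. intros [F' H] Hz. exact (cderiv_cont _ _ _ (proj1 (H z Hz))). Qed.

Lemma hol_const c : hol U (fun _ => c).
Proof. exists (fun _ => 0). intros z _. split; [apply cderiv_const|apply ccont_const]. Qed.

Lemma hol_id : hol U (fun z => z).
Proof. exists (fun _ => 1). intros z _. split; [apply cderiv_id|apply ccont_const]. Qed.

Lemma hol_plus F G : hol U F -> hol U G -> hol U (fun z => F z + G z).
Proof.
  intros [F' H] [G' K]. exists (fun z => F' z + G' z). intros z Hz.
  destruct (H z Hz), (K z Hz). split; [now apply cderiv_plus|now apply ccont_plus].
Qed.

Lemma hol_minus F G : hol U F -> hol U G -> hol U (fun z => F z - G z).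
Proof.
  intros [F' H] [G' K]. exists (fun z => F' z - G' z). intros z Hz.
  destruct (H z Hz), (K z Hz). split; [now apply cderiv_minus|now apply ccont_minus].
Qed.

Lemma hol_mult F G : hol U F -> hol U G -> hol U (fun z => F z * G z).
Proof.
  intros HF HG. assert (CF := fun z => hol_cont F z HF). assert (CG := fun z => hol_cont G z HG).
  destruct HF as [F' H], HG as [G' K]. exists (fun z => F' z * G z + F z * G' z). intros z Hz.
  destruct (H z Hz), (K z Hz). split; [now apply cderiv_mult|].
  apply ccont_plus; apply ccont_mult; auto.
Qed.

Lemma hol_inv F : hol U F -> (forall z, U z -> F z <> 0) -> hol U (fun z => / F z).
Proof.
  intros HF N. assert (CF := fun z => hol_cont F z HF).
  destruct HF as [F' H]. exists (fun z => - F' z / (F z * F z)). intros z Hz.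
  destruct (H z Hz) as [H1 H2]. split; [apply cderiv_inv; auto|].
  apply ccont_mult.
  - apply (@continuous_opp Cfield C_AbsRing Cfield). exact H2.
  - apply ccont_inv; [apply ccont_mult; auto|]. apply Cmult_neq_0; auto.
Qed.

Lemma hol_sub (V : C -> Prop) F : (forall z, V z -> U z) -> hol U F -> hol V F.
Proof. intros S [F' H]. exists F'. auto. Qed.
End Hol.

Ltac hol_tac :=
  lazymatch goal with
  | |- hol _ (fun _ => ?c) => apply hol_const
  | |- hol _ (fun z => z) => apply hol_id
  | |- hol _ (fun z => Cplus (@?a z) (@?b z)) => apply (hol_plus _ a b); hol_tac
  | |- hol _ (fun z => Cminus (@?a z) (@?b z)) => apply (hol_minus _ a b); hol_tac
  | |- hol _ (fun z => Cmult (@?a z) (@?b z)) => apply (hol_mult _ a b); hol_tac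
  | |- hol _ (fun z => Cinv _) => idtac
  | |- _ => try assumption
  end.

(** * Real parts along real curves *)

Lemma locally_R_eps (t : R) (P : R -> Prop) :
  locally t P <-> exists d : posreal, forall s, (Rabs (s - t) < d)%R -> P s.
Proof. split; intros [d H]; exists d; intros s Hs; apply H; exact Hs. Qed.

Lemma is_derive_R_eps (f : R -> R) (t l : R) :
  is_derive f t l <-> forall eps : posreal, exists d : posreal, forall s, (Rabs (s - t) < d)%R ->
   (Rabs (f s - f t - l * (s - t)) <= eps * Rabs (s - t))%R.
Proof.
  split.
  - intros [_ H] eps.
    specialize (H t (fun P HP => HP) eps).
    apply locally_R_eps in H. destruct H as [d H]. exists d. intros w Hw.
    specialize (H w Hw).
    replace (l * (w - t))%R with ((w - t) * l)%R by ring. exact H.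
  - intros H. split; [apply is_linear_scal_l|].
    intros x Hx eps.
    assert (E := @is_filter_lim_locally_unique _ R_NormedModule t x Hx). subst x.
    apply locally_R_eps. destruct (H eps) as [d Hd]. exists d. intros w Hw.
    specialize (Hd w Hw).
    replace (l * (w - t))%R with ((w - t) * l)%R in Hd by ring. exact Hd.
Qed.

Lemma Cmod_le_abs (a b : R) : (Cmod (a, b) <= Rabs a + Rabs b)%R.
Proof.
  replace ((a, b) : C) with (RtoC a + Ci * RtoC b).
  - eapply Rle_trans; [apply Cmod_triangle|]. rewrite Cmod_mult, Cmod_Ci, !Cmod_R. lra.
  - unfold RtoC, Ci, Cplus, Cmult; simpl. f_equal; ring.
Qed.

Lemma is_derive_Re_comp (F : C -> C) (x y : R -> R) (t a b : R) (l : C) :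
  cderiv F (x t, y t) l -> is_derive x t a -> is_derive y t b ->
  is_derive (fun s => Re (F (x s, y s))) t (Re (l * (a, b))).
Proof.
  intros HF Hx Hy. rewrite is_derive_R_eps in *. rewrite cderiv_eps in HF.
  intros eps. remember (Re (l * (a, b))) as L eqn:EL.
  (* A Lipschitz constant of the curve at [t]: each coordinate is allowed an extra slope of 1, since
     its tolerance below is at most 1. *)
  set (M := (Rabs a + Rabs b + 2)%R).
  assert (Ma := Rabs_pos a). assert (Mb := Rabs_pos b). assert (Ml := Cmod_ge_0 l).
  assert (Pe := cond_pos eps).
  assert (HM : (0 < M)%R) by (unfold M; lra).
  assert (P1 : (0 < eps / (2 * M))%R) by (apply Rdiv_lt_0_compat; lra).
  (* Half of [eps] is spent on [F], half on the curve; the errors of the two coordinates add up and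
     are multiplied by [|l|], whence the factor 4. *)
  assert (P2 : (0 < Rmin 1 (eps / (4 * (Cmod l + 1))))%R).
  { apply Rmin_pos; [lra|]. apply Rdiv_lt_0_compat; lra. }
  destruct (HF (mkposreal _ P1)) as [d Hd]. simpl in Hd.
  destruct (Hx (mkposreal _ P2)) as [dx Hdx]. destruct (Hy (mkposreal _ P2)) as [dy Hdy]. simpl in *.
  assert (P3 : (0 < Rmin (Rmin dx dy) (d / M))%R).
  { apply Rmin_pos; [apply Rmin_pos; apply cond_pos|]. apply Rdiv_lt_0_compat; [apply cond_pos|lra]. }
  exists (mkposreal _ P3). simpl. intros s Hs.
  assert (S0 := Rlt_le_trans _ _ _ Hs (Rmin_l _ _)).
  assert (S1 := Rlt_le_trans _ _ _ S0 (Rmin_l _ _)).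
  assert (S2 := Rlt_le_trans _ _ _ S0 (Rmin_r _ _)).
  assert (S3 := Rlt_le_trans _ _ _ Hs (Rmin_r _ _)).
  specialize (Hdx s S1). specialize (Hdy s S2).
  set (e2 := Rmin 1 (eps / (4 * (Cmod l + 1)))%R) in *.
  assert (E1 : (e2 <= 1)%R) by apply Rmin_l.
  assert (E2 : (e2 * (4 * (Cmod l + 1)) <= eps)%R).
  { apply Rle_trans with (eps / (4 * (Cmod l + 1)) * (4 * (Cmod l + 1)))%R.
    - apply Rmult_le_compat_r; [lra|apply Rmin_r].
    - right. field. lra. }
  set (h := (s - t)%R) in *. assert (Hh := Rabs_pos h).
  assert (Ex : (Rabs (x s - x t) <= (Rabs a + 1) * Rabs h)%R).
  { replace (x s - x t)%R with ((x s - x t - a * h) + a * h)%R by ring.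
    eapply Rle_trans; [apply Rabs_triang|]. rewrite Rabs_mult. nra. }
  assert (Ey : (Rabs (y s - y t) <= (Rabs b + 1) * Rabs h)%R).
  { replace (y s - y t)%R with ((y s - y t - b * h) + b * h)%R by ring.
    eapply Rle_trans; [apply Rabs_triang|]. rewrite Rabs_mult. nra. }
  assert (D : (x s, y s) - (x t, y t) = ((x s - x t)%R, (y s - y t)%R)) by reflexivity.
  assert (N1 : (Cmod ((x s, y s) - (x t, y t)) <= M * Rabs h)%R).
  { rewrite D. eapply Rle_trans; [apply Cmod_le_abs|]. unfold M. lra. }
  assert (N2 : (Cmod ((x s, y s) - (x t, y t)) < d)%R).
  { eapply Rle_lt_trans; [exact N1|]. apply (Rmult_lt_compat_l M) in S3; [|lra].
    replace (M * (d / M))%R with (d : R) in S3 by (field; lra). exact S3. }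
  specialize (Hd _ N2).
  assert (N3 : (Cmod ((x s, y s) - (x t, y t) - (a, b) * RtoC h) <= 2 * e2 * Rabs h)%R).
  { replace ((x s, y s) - (x t, y t) - (a, b) * RtoC h) with
     (((x s - x t - a * h)%R, (y s - y t - b * h)%R) : C).
    - eapply Rle_trans; [apply Cmod_le_abs|]. lra.
    - rewrite D. unfold Cminus, Cplus, Copp, Cmult, RtoC; simpl. f_equal; ring. }
  replace (Re (F (x s, y s)) - Re (F (x t, y t)) - L * h)%R with
    (Re (F (x s, y s) - F (x t, y t) - l * (a, b) * RtoC h)).
  2: { rewrite EL. unfold Re, Cminus, Cplus, Copp, Cmult, RtoC; simpl. ring. }
  eapply Rle_trans; [apply re_le_Cmod|].
  replace (F (x s, y s) - F (x t, y t) - l * (a, b) * RtoC h) with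
    ((F (x s, y s) - F (x t, y t) - l * ((x s, y s) - (x t, y t)))
     + l * ((x s, y s) - (x t, y t) - (a, b) * RtoC h)) by ring.
  eapply Rle_trans; [apply Cmod_triangle|]. rewrite Cmod_mult.
  assert (K1 : (eps / (2 * M) * Cmod ((x s, y s) - (x t, y t)) <= eps / 2 * Rabs h)%R).
  { apply Rle_trans with (eps / (2 * M) * (M * Rabs h))%R.
    - apply Rmult_le_compat_l; lra.
    - right. field. lra. }
  assert (K2 : (Cmod l * Cmod ((x s, y s) - (x t, y t) - (a, b) * RtoC h) <= eps / 2 * Rabs h)%R).
  { apply Rle_trans with (Cmod l * (2 * e2 * Rabs h))%R; [now apply Rmult_le_compat_l|].
    assert (0 < e2)%R by exact P2. nra. }
  lra.
Qed.

(** * Means of the real part over circles *)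

Definition circ (s t : R) : C := (s * cos t, s * sin t)%R.

Lemma Cmod_circ (s t : R) : (0 <= s)%R -> Cmod (circ s t) = s.
Proof.
  intros H. unfold Cmod, circ; simpl.
  replace (s * cos t * (s * cos t * 1) + s * sin t * (s * sin t * 1))%R with (s * s)%R.
  - now apply sqrt_square.
  - assert (E := sin2_cos2 t). unfold Rsqr in E. nra.
Qed.

Lemma continuity_2d_pt_Re (F : C -> C) (x y : R -> R -> R) (s t : R) :
  continuity_2d_pt x s t -> continuity_2d_pt y s t -> ccont F (x s t, y s t) ->
  continuity_2d_pt (fun u v => Re (F (x u v, y u v))) s t.
Proof.
  intros Hx Hy HF eps. rewrite ccont_eps in HF.
  destruct (HF eps) as [d Hd].
  assert (P : (0 < d / 2)%R) by (assert (T := cond_pos d); lra).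
  generalize (locally_2d_and _ _ _ _ (Hx (mkposreal _ P)) (Hy (mkposreal _ P))).
  apply locally_2d_impl, locally_2d_forall. simpl. intros u v [Hu Hv].
  replace (Re (F (x u v, y u v)) - Re (F (x s t, y s t)))%R
    with (Re (F (x u v, y u v) - F (x s t, y s t))) by reflexivity.
  eapply Rle_lt_trans; [apply re_le_Cmod|]. apply Hd.
  eapply Rle_lt_trans; [apply Cmod_le_abs|]. simpl. unfold Rminus in Hu, Hv. lra.
Qed.

Lemma ccont_scal (c : C) (F : C -> C) (z : C) : ccont F z -> ccont (fun w => c * F w) z.
Proof. intros H. apply ccont_mult; [apply ccont_const|exact H]. Qed.

Lemma radial_continuity (F : C -> C) (s t : R) :
  ccont F (circ s t) ->
  continuity_2d_pt (fun u v => Re (F (circ u v) * (cos v, sin v))) s t.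
Proof.
  intros HF.
  assert (Cc : continuity_2d_pt (fun _ v => cos v) s t).
  { apply (continuity_1d_2d_pt_comp cos (fun _ v => v)); [apply continuity_cos|apply continuity_2d_pt_id2]. }
  assert (Cs : continuity_2d_pt (fun _ v => sin v) s t).
  { apply (continuity_1d_2d_pt_comp sin (fun _ v => v)); [apply continuity_sin|apply continuity_2d_pt_id2]. }
  (* The imaginary part is written as the real part of [- Ci * F], so that [continuity_2d_pt_Re]
     serves for both. *)
  apply continuity_2d_pt_ext with
   (fun u v => Re (F (circ u v)) * cos v - Re (- Ci * F (circ u v)) * sin v)%R.
  { intros u v. unfold Re, Ci, Cmult, Copp; simpl. ring. }
  assert (Cx : continuity_2d_pt (fun u v => u * cos v)%R s t).
  { apply continuity_2d_pt_mult; [apply continuity_2d_pt_id1|exact Cc]. }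
  assert (Cy : continuity_2d_pt (fun u v => u * sin v)%R s t).
  { apply continuity_2d_pt_mult; [apply continuity_2d_pt_id1|exact Cs]. }
  apply continuity_2d_pt_minus; apply continuity_2d_pt_mult; auto.
  - apply (continuity_2d_pt_Re F (fun u v => u * cos v)%R (fun u v => u * sin v)%R); auto.
  - apply (continuity_2d_pt_Re (fun z => - Ci * F z) (fun u v => u * cos v)%R (fun u v => u * sin v)%R); auto.
    apply ccont_scal; auto.
Qed.

Definition punctured (z : C) : Prop := (0 < Cmod z < 1)%R.

Section CircleMean.
Variables F F' : C -> C.
Hypothesis HF : forall z, punctured z -> cderiv F z (F' z) /\ ccont F' z.

Let dF (s t : R) : R := Re (F' (circ s t) * (cos t, sin t)).

Lemma punctured_circ (s t : R) : (0 < s < 1)%R -> punctured (circ s t).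
Proof. intros H. unfold punctured. rewrite Cmod_circ; lra. Qed.

Lemma circle_radial (s t : R) : (0 < s < 1)%R -> is_derive (fun u => Re (F (circ u t))) s (dF s t).
Proof.
  intros H. destruct (HF _ (punctured_circ s t H)) as [D _].
  apply (is_derive_Re_comp F (fun u => u * cos t)%R (fun u => u * sin t)%R); [exact D| |];
  auto_derive; auto; ring.
Qed.

(** Cauchy-Riemann in polar form: the radial derivative of [Re F] is the angular derivative of
    [Im F / s], with [Im F] written as [Re (- Ci * F)]. *)
Lemma circle_angular (s t : R) : (0 < s < 1)%R ->
  is_derive (fun v => Re (- Ci * F (circ s v)) / s)%R t (dF s t).
Proof.
  intros H. destruct (HF _ (punctured_circ s t H)) as [D _].
  assert (D' : cderiv (fun z => - Ci * F z) (circ s t) (- Ci * F' (circ s t))).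
  { eapply cderiv_ext; [reflexivity| |apply cderiv_mult; [apply cderiv_const|exact D]]. cbv beta. ring. }
  assert (Dx : is_derive (fun v => s * cos v)%R t (- (s * sin t))%R) by (auto_derive; auto; ring).
  assert (Dy : is_derive (fun v => s * sin v)%R t (s * cos t)%R) by (auto_derive; auto; ring).
  assert (K := is_derive_Re_comp (fun z => - Ci * F z) _ _ t _ _ _ D' Dx Dy).
  apply (is_derive_scal _ _ (/ s)) in K.
  refine (is_derive_ext _ _ _ _ _ _).
  2: { replace (dF s t) with (/ s * Re (- Ci * F' (circ s t) * ((- (s * sin t))%R, (s * cos t)%R)))%R.
    - exact K.
    - unfold dF, Re, Ci, Cmult, Copp; simpl. field. lra. }
  intros v. change (/ s * Re (- Ci * F (circ s v)) = Re (- Ci * F (circ s v)) / s)%R. apply Rmult_comm.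
Qed.

Lemma dF_continuity (s t : R) : (0 < s < 1)%R -> continuity_2d_pt dF s t.
Proof. intros H. apply radial_continuity. now apply HF, punctured_circ. Qed.

Lemma dF_continuous (s t : R) : (0 < s < 1)%R -> continuous (dF s) t.
Proof.
  intros H. apply (continuous_comp_2 (fun _ => s) (fun v : R => v) dF).
  - apply continuous_const.
  - apply continuous_id.
  - apply continuity_2d_pt_filterlim. now apply dF_continuity.
Qed.

Let mean (s : R) : R := RInt (fun t => Re (F (circ s t))) 0 (2 * PI).

Lemma circle_ex_RInt (s : R) : (0 < s < 1)%R -> ex_RInt (fun t => Re (F (circ s t))) 0 (2 * PI).
Proof.
  intros H. apply (ex_RInt_continuous (V := R_CompleteNormedModule)). intros t _.
  apply (ex_derive_continuous (fun t => Re (F (circ s t)))).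
  destruct (HF _ (punctured_circ s t H)) as [D _].
  assert (Dx : is_derive (fun v => s * cos v)%R t (- (s * sin t))%R) by (auto_derive; auto; ring).
  assert (Dy : is_derive (fun v => s * sin v)%R t (s * cos t)%R) by (auto_derive; auto; ring).
  eexists. exact (is_derive_Re_comp F _ _ t _ _ _ D Dx Dy).
Qed.

(** Under the integral sign the radial derivative is an exact angular derivative of a periodic
    function, so it integrates to [0] over a full turn. *)
Lemma circle_mean_derive (s : R) : (0 < s < 1)%R -> is_derive mean s 0.
Proof.
  intros H.
  assert (L : locally s (fun u => 0 < u < 1)%R).
  { apply (locally_interval _ s 0 1); simpl; lra || auto. }
  assert (E : RInt (fun t => Derive (fun u => Re (F (circ u t))) s) 0 (2 * PI) = 0%R).
  { rewrite (RInt_ext _ (dF s)).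
    2: { intros t _. apply is_derive_unique. now apply circle_radial. }
    apply is_RInt_unique.
    replace 0%R with (minus (Re (- Ci * F (circ s (2 * PI))) / s) (Re (- Ci * F (circ s 0)) / s))%R at 2.
    - apply (is_RInt_derive (V := R_CompleteNormedModule) (fun v => Re (- Ci * F (circ s v)) / s)%R).
      + intros t _. now apply circle_angular.
      + intros t _. now apply dF_continuous.
    - unfold circ. rewrite cos_2PI, sin_2PI, cos_0, sin_0.
      apply (minus_eq_zero (G := R_AbelianGroup)). }
  rewrite <- E.
  apply (is_derive_RInt_param (fun u t => Re (F (circ u t)))).
  - revert L. apply filter_imp. intros u Hu t _. eexists. now apply circle_radial.
  - intros t _. apply (continuity_2d_pt_ext_loc dF).
    + destruct L as [d Hd]. exists d. intros u v Hu Hv. symmetry. apply is_derive_unique.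
      apply circle_radial. apply Hd. exact Hu.
    + now apply dF_continuity.
  - revert L. apply filter_imp. intros u Hu. now apply circle_ex_RInt.
Qed.

Lemma circle_mean_const (r s : R) : (0 < r < 1)%R -> (0 < s < r)%R -> mean s = mean r.
Proof.
  intros Hr Hs. apply (eq_is_derive (V := R_NormedModule)); [|lra].
  intros t Ht. apply circle_mean_derive. lra.
Qed.

(* The mean of [Re F] over a circle does not depend on the radius; by the
   vanishing of [F] at [0] it is [0], so [Re F] has no negative upper bound on a circle. *)
Lemma circle_bound (M d r K : R) :
  (0 < d)%R -> (forall z, (0 < Cmod z < d)%R -> (Cmod (F z) <= M * Cmod z)%R) ->
  (0 < r < 1)%R -> (forall z, Cmod z = r -> (Re (F z) <= K)%R) -> (0 <= K)%R.
Proof.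
  intros Hd HM Hr HK.
  assert (PI0 := PI_RGT_0).
  assert (U : (mean r <= 2 * PI * K)%R).
  { unfold mean. replace (2 * PI * K)%R with (RInt (fun _ => K) 0 (2 * PI)).
    - apply RInt_le; [lra|now apply circle_ex_RInt|apply ex_RInt_const|].
      intros t _. apply HK. apply Cmod_circ. lra.
    - rewrite RInt_const. change (((2 * PI - 0) * K)%R = (2 * PI * K)%R). ring. }
  destruct (Rle_or_lt 0 K) as [|N]; [assumption|exfalso].
  assert (PM : (0 < Rabs M + 1)%R) by (assert (T := Rabs_pos M); lra).
  (* On a circle this small [Re F >= - |M| s > K], so its mean exceeds the one at radius [r],
     against constancy. *)
  set (s := (Rmin (Rmin d r) (- K / (Rabs M + 1)) / 2)%R).
  assert (P : (0 < Rmin (Rmin d r) (- K / (Rabs M + 1)))%R).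
  { apply Rmin_pos; [apply Rmin_pos; lra|]. apply Rdiv_lt_0_compat; lra. }
  assert (S1 := Rmin_l (Rmin d r) (- K / (Rabs M + 1))).
  assert (S2 := Rmin_r (Rmin d r) (- K / (Rabs M + 1))).
  assert (S3 := Rmin_l d r). assert (S4 := Rmin_r d r).
  assert (Hs : (0 < s < r /\ s < d)%R) by (unfold s; lra).
  assert (B : (Rabs M * s < - K)%R).
  { assert (s * (Rabs M + 1) < - K)%R; [|lra].
    replace (- K)%R with (- K / (Rabs M + 1) * (Rabs M + 1))%R by (field; lra).
    apply Rmult_lt_compat_r; [lra|]. unfold s. lra. }
  assert (Lo : (- (Rabs M * s) * (2 * PI) <= mean s)%R).
  { unfold mean. replace (- (Rabs M * s) * (2 * PI))%R with (RInt (fun _ => - (Rabs M * s))%R 0 (2 * PI)).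
    - apply RInt_le; [lra|apply ex_RInt_const|apply circle_ex_RInt; lra|].
      intros t _. assert (T := HM (circ s t)). rewrite Cmod_circ in T by lra.
      specialize (T ltac:(lra)). assert (T2 := re_le_Cmod (F (circ s t))).
      assert (T3 := Rle_abs (- Re (F (circ s t)))). rewrite Rabs_Ropp in T3.
      assert (T4 := Rle_abs M). nra.
    - rewrite RInt_const. change (((2 * PI - 0) * (- (Rabs M * s)))%R = (- (Rabs M * s) * (2 * PI))%R). ring. }
  rewrite (circle_mean_const r s) in Lo by lra. nra.
Qed.
End CircleMean.

(** * Complex power series on the disk and termwise differentiation *)

Definition psum (b : nat -> C) (F : C -> C) : Prop :=
  forall z, unit_disk z -> @is_series C_AbsRing C_NormedModule (fun k => b k * z ^ k) (F z).

Lemma series_Cmod_le (u : nat -> C) (v : nat -> R) (l : C) (m : R) :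
  @is_series C_AbsRing C_NormedModule u l -> is_series v m ->
  (forall k, (Cmod (u k) <= v k)%R) -> (Cmod l <= m)%R.
Proof.
  intros Hu Hv H.
  apply (is_lim_seq_le (fun n => Cmod (@sum_n C_NormedModule u n)) (sum_n v) (Cmod l) m).
  - intros n. induction n as [|n IH].
    + rewrite !sum_O. apply H.
    + rewrite !sum_Sn. eapply Rle_trans; [apply Cmod_triangle|].
      apply Rplus_le_compat; [exact IH|apply H].
  - unfold is_lim_seq. eapply filterlim_comp; [exact Hu|].
    exact (@filterlim_norm C_AbsRing C_NormedModule l).
  - exact Hv.
Qed.

Section PowerSeries.
Variables (b : nat -> C) (F : C -> C).
Hypothesis HF : psum b F.

Let A (k : nat) : R := Cmod (b k).
Let b' (k : nat) : C := RtoC (INR (S k)) * b (S k).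

(** Partial sums of a convergent series are bounded and each term is a difference of two of them.
    Bounded terms place [r] within the radius of the real series of moduli, to which the real theory
    of power series applies. *)
Lemma CV_radius_coef (r : R) : (0 <= r < 1)%R -> Rbar_le r (CV_radius A).
Proof.
  intros Hr. apply (proj1 (CV_radius_bounded A)).
  assert (D : unit_disk (RtoC r)).
  { unfold unit_disk. rewrite Cmod_R, Rabs_pos_eq; lra. }
  assert (S := HF _ D).
  destruct (@filterlim_bounded C_AbsRing C_NormedModule _ (ex_intro _ _ S)) as [M HM].
  exists (M + M)%R. intros n.
  replace (Rabs (A n * r ^ n)) with (Cmod (b n * RtoC r ^ n)).
  2: { rewrite Cmod_mult, Cmod_pow, Cmod_R, Rabs_mult, <- RPow_abs, (Rabs_pos_eq (A n)); [reflexivity|apply Cmod_ge_0]. }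
  assert (M0 := Rle_trans _ _ _ (Cmod_ge_0 _) (HM 0%nat)).
  destruct n as [|n].
  - specialize (HM 0%nat). rewrite sum_O in HM.
    change (Cmod (b 0%nat * RtoC r ^ 0) <= M)%R in HM. lra.
  - assert (H1 := HM n). assert (H2 := HM (Datatypes.S n)). rewrite sum_Sn in H2.
    set (u := @sum_n C_NormedModule (fun k => b k * RtoC r ^ k) n) in *.
    change (Cmod u <= M)%R in H1.
    change (Cmod (u + b (Datatypes.S n) * RtoC r ^ Datatypes.S n) <= M)%R in H2.
    assert (T := Cmod_triangle (u + b (Datatypes.S n) * RtoC r ^ Datatypes.S n) (- u)).
    rewrite Cmod_opp in T.
    replace (u + b (Datatypes.S n) * RtoC r ^ Datatypes.S n + - u) with
      (b (Datatypes.S n) * RtoC r ^ Datatypes.S n) in T by ring.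
    lra.
Qed.

Lemma CV_radius_coef_lt (r : R) : (0 <= r < 1)%R -> Rbar_lt r (CV_radius A).
Proof.
  intros Hr. apply Rbar_lt_le_trans with ((r + 1) / 2)%R; [simpl; lra|].
  apply CV_radius_coef. lra.
Qed.

Lemma ex_series_coef_derive (r : R) : (0 <= r < 1)%R ->
  ex_series (fun k => INR (S k) * A (S k) * r ^ k)%R.
Proof.
  intros Hr.
  assert (E := CV_disk_inside (PS_derive A) r).
  rewrite CV_radius_derive, Rabs_pos_eq in E by lra.
  eapply ex_series_ext; [|apply E; now apply CV_radius_coef_lt].
  intros k. unfold PS_derive. apply Rabs_pos_eq.
  apply Rmult_le_pos; [apply Rmult_le_pos; [apply pos_INR|apply Cmod_ge_0]|apply pow_le; lra].
Qed.

Lemma ex_series_coef_derive2 (r : R) : (0 <= r < 1)%R ->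
  ex_series (fun k => INR k * INR (k - 1) * A k * r ^ (k - 2))%R.
Proof.
  intros Hr. apply (ex_series_incr_n _ 2).
  assert (E := CV_disk_inside (PS_derive (PS_derive A)) r).
  rewrite !CV_radius_derive, Rabs_pos_eq in E by lra.
  eapply ex_series_ext; [|apply E; now apply CV_radius_coef_lt].
  intros k. unfold PS_derive. rewrite Rabs_pos_eq.
  - replace (2 + k - 1)%nat with (S k) by lia. replace (2 + k - 2)%nat with k by lia.
    change (2 + k)%nat with (S (S k)).
    match goal with |- ?x = ?y => change (@eq R x y) end. ring.
  - repeat apply Rmult_le_pos; try apply pos_INR; [apply Cmod_ge_0|apply pow_le; lra].
Qed.

(** Induction on the remainder: [R(k+1) = w R(k) + k z^(k-1) (w - z)^2]. Weighted by [|b k|] and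
    summed, the bound controls the second-order remainder of the whole series. *)
Lemma pow_taylor_bound (z w : C) (r : R) (k : nat) :
  (Cmod z <= r)%R -> (Cmod w <= r)%R ->
  (Cmod (w ^ k - z ^ k - RtoC (INR k) * z ^ (k - 1) * (w - z))
    <= INR k * INR (k - 1) * r ^ (k - 2) * Cmod (w - z) ^ 2)%R.
Proof.
  intros Hz Hw. assert (Pr := Rle_trans _ _ _ (Cmod_ge_0 z) Hz).
  induction k as [|k IH].
  - replace (w ^ 0 - z ^ 0 - RtoC (INR 0) * z ^ (0 - 1) * (w - z)) with (RtoC 0) by (simpl; ring).
    rewrite Cmod_0. simpl. right; ring.
  - destruct k as [|k].
    + replace (w ^ 1 - z ^ 1 - RtoC (INR 1) * z ^ (1 - 1) * (w - z)) with (RtoC 0) by (simpl; ring).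
      rewrite Cmod_0. simpl.
      right; ring.
    + set (d := Cmod (w - z)) in *.
      replace (w ^ S (S k) - z ^ S (S k) - RtoC (INR (S (S k))) * z ^ (S (S k) - 1) * (w - z)) with
       (w * (w ^ S k - z ^ S k - RtoC (INR (S k)) * z ^ (S k - 1) * (w - z))
        + RtoC (INR (S k)) * z ^ k * ((w - z) * (w - z))).
      2: { replace (S (S k) - 1)%nat with (S k) by lia. replace (S k - 1)%nat with k by lia.
           rewrite (S_INR (S k)), RtoC_plus. simpl. ring. }
      eapply Rle_trans; [apply Cmod_triangle|].
      rewrite !Cmod_mult, Cmod_pow, Cmod_R, (Rabs_pos_eq (INR _)) by apply pos_INR. fold d.
      assert (Q : (Cmod z ^ k <= r ^ k)%R).
      { apply pow_incr. split; [apply Cmod_ge_0|exact Hz]. }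
      assert (Pd : (0 <= d * d)%R) by (apply Rmult_le_pos; apply Cmod_ge_0).
      assert (Pk := pos_INR (S k)).
      apply Rle_trans with (r * (INR (S k) * INR (S k - 1) * r ^ (S k - 2) * d ^ 2)
        + INR (S k) * r ^ k * (d * d))%R.
      * apply Rplus_le_compat.
        -- apply Rmult_le_compat; auto using Cmod_ge_0.
        -- apply Rmult_le_compat_r; [exact Pd|]. apply Rmult_le_compat_l; assumption.
      * assert (Pk' := pow_le r k Pr).
        replace (S (S k) - 1)%nat with (S k) by lia. replace (S (S k) - 2)%nat with k by lia.
        replace (S k - 1)%nat with k by lia.
        assert (E : (r * (INR (S k) * INR k * r ^ (S k - 2) * d ^ 2) = INR (S k) * INR k * r ^ k * d ^ 2)%R).
        { destruct k as [|k]; [simpl; ring|].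
          replace (S (S k) - 2)%nat with k by lia. simpl (r ^ S k)%R. ring. }
        rewrite E, (S_INR (S k)), (S_INR k).
        assert (K0 := pos_INR k).
        assert (0 <= (INR k + 1) * r ^ k * (d * d))%R.
        { repeat apply Rmult_le_pos; auto; try lra; apply Cmod_ge_0. }
        nra.
Qed.

Lemma psum_derive_pointwise (z : C) : unit_disk z ->
  exists l, @is_series C_AbsRing C_NormedModule (fun k => b' k * z ^ k) l /\ cderiv F z l.
Proof.
  intros Hz. unfold unit_disk in Hz. assert (Z0 := Cmod_ge_0 z).
  assert (EX : @ex_series C_AbsRing C_CompleteNormedModule (fun k => b' k * z ^ k)).
  { apply (ex_series_le _ (fun k => INR (S k) * A (S k) * Cmod z ^ k)%R).
    - intros k. change (Cmod (b' k * z ^ k) <= INR (S k) * A (S k) * Cmod z ^ k)%R.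
      unfold b'. rewrite !Cmod_mult, Cmod_pow, Cmod_R, Rabs_pos_eq by apply pos_INR. right; reflexivity.
    - apply ex_series_coef_derive. lra. }
  destruct EX as [l Hl]. change C in l. exists l. split; [exact Hl|].
  set (r := ((Cmod z + 1) / 2)%R). assert (Hr : (Cmod z < r < 1)%R) by (unfold r; lra).
  destruct (ex_series_coef_derive2 r) as [V HV]; [lra|].
  (* The series scaled by [0] is dominated termwise by the one of [V]. *)
  assert (V0 : (0 <= V)%R).
  { assert (Z := is_series_scal (RtoC 0) _ _ Hl).
    eapply Rle_trans; [apply Cmod_ge_0|]. apply (series_Cmod_le _ _ _ _ Z HV).
    intros k. change (Cmod (0 * (b' k * z ^ k)) <= INR k * INR (k - 1) * A k * r ^ (k - 2))%R.
    rewrite Cmult_0_l, Cmod_0.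
    repeat apply Rmult_le_pos; try apply pos_INR; [apply Cmod_ge_0|apply pow_le; lra]. }
  (* Reindexed so that each derivative term faces [b k * z ^ k]; the new term at [k = 0] vanishes
     through [INR 0], whatever the truncated exponent. *)
  assert (Hl' : @is_series C_AbsRing C_NormedModule (fun k => RtoC (INR k) * b k * z ^ (k - 1)) l).
  { apply is_series_decr_1.
    match goal with |- is_series _ ?x => replace x with (l : C) end.
    - refine (is_series_ext _ _ _ _ Hl). intros k. replace (S k - 1)%nat with k by lia. reflexivity.
    - change (@eq C l (l + - (RtoC 0 * b 0%nat * z ^ (0 - 1)))). ring. }
  apply cderiv_eps. intros eps.
  assert (Pd : (0 < Rmin (r - Cmod z) (eps / (V + 1)))%R).
  { apply Rmin_pos; [lra|]. apply Rdiv_lt_0_compat; [apply cond_pos|lra]. }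
  exists (mkposreal _ Pd). simpl. intros w Hw.
  assert (W1 := Rlt_le_trans _ _ _ Hw (Rmin_l _ _)).
  assert (W2 := Rlt_le_trans _ _ _ Hw (Rmin_r _ _)).
  assert (Hwr : (Cmod w <= r)%R).
  { assert (T := Cmod_triangle z (w - z)). replace (z + (w - z)) with w in T by ring. lra. }
  assert (S1 := HF w ltac:(unfold unit_disk; lra)).
  assert (S2 := HF z Hz).
  assert (S3 := is_series_scal (w - z) _ _ Hl').
  assert (S4 := is_series_minus _ _ _ _ (is_series_minus _ _ _ _ S1 S2) S3).
  assert (S5 := is_series_scal (Cmod (w - z) ^ 2)%R _ _ HV).
  assert (B := fun H => series_Cmod_le _ _ _ _ S4 S5 H).
  apply Rle_trans with (Cmod (w - z) ^ 2 * V)%R.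
  - replace (F w - F z - l * (w - z)) with (F w - F z - (w - z) * l) by ring.
    apply B. intros k.
    change (Cmod (b k * w ^ k - b k * z ^ k - (w - z) * (RtoC (INR k) * b k * z ^ (k - 1)))
      <= Cmod (w - z) ^ 2 * (INR k * INR (k - 1) * A k * r ^ (k - 2)))%R.
    replace (b k * w ^ k - b k * z ^ k - (w - z) * (RtoC (INR k) * b k * z ^ (k - 1))) with
      (b k * (w ^ k - z ^ k - RtoC (INR k) * z ^ (k - 1) * (w - z))) by ring.
    rewrite Cmod_mult.
    assert (T := pow_taylor_bound z w r k ltac:(lra) Hwr).
    apply (Rmult_le_compat_l (A k)) in T; [|apply Cmod_ge_0]. fold (A k).
    eapply Rle_trans; [exact T|]. right; ring.
  - assert (D0 := Cmod_ge_0 (w - z)).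
    assert (Cmod (w - z) * (V + 1) <= eps)%R.
    { replace (pos eps) with (eps / (V + 1) * (V + 1))%R by (field; lra).
      apply Rmult_le_compat_r; lra. }
    nra.
Qed.
End PowerSeries.

Lemma cderiv_C_derive (F : C -> C) (z l : C) : cderiv F z l -> C_derive F z = l.
Proof.
  intros H. apply (cderiv_unique F z); [|exact H].
  apply cderiv_C_NormedModule. apply (C_derive_correct F z 0). exists l. now apply cderiv_C_NormedModule.
Qed.

Lemma psum_C_derive (b : nat -> C) (F : C -> C) : psum b F ->
  psum (fun k => RtoC (INR (S k)) * b (S k)) (C_derive F) /\
  (forall z, unit_disk z -> cderiv F z (C_derive F z)).
Proof.
  intros H. split; intros z Hz; destruct (psum_derive_pointwise b F H z Hz) as [l [S D]];
  rewrite (cderiv_C_derive _ _ _ D); assumption.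
Qed.

Lemma psum_hol (b : nat -> C) (F : C -> C) : psum b F -> hol unit_disk F.
Proof.
  intros H. destruct (psum_C_derive _ _ H) as [H1 D1]. destruct (psum_C_derive _ _ H1) as [_ D2].
  exists (C_derive F). intros z Hz. split; [auto|]. exact (cderiv_cont _ _ _ (D2 z Hz)).
Qed.

(** * Contractive Toeplitz matrices and the coefficient functional *)

(** Polynomial in the coordinates, so that [ring] decides the quadratic identities below; [Cmod]
    would bring in square roots. *)
Definition sqmod (x : C) : R := (Re x ^ 2 + Im x ^ 2)%R.

Lemma sqmod_Cmod (x : C) : sqmod x = (Cmod x ^ 2)%R.
Proof. symmetry. apply Cmod2_alt. Qed.

Lemma sqmod_ge_0 (x : C) : (0 <= sqmod x)%R.
Proof. unfold sqmod. nra. Qed.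

Lemma Cmod_le_of_sqmod (x : C) (m : R) : (0 <= m)%R -> (sqmod x <= m ^ 2)%R -> (Cmod x <= m)%R.
Proof. intros Hm H. rewrite sqmod_Cmod in H. assert (T := Cmod_ge_0 x). nra. Qed.

Ltac coords := unfold sqmod, Re, Im, Cconj, RtoC, Cmult, Cplus, Cminus, Copp; simpl.

Section Toeplitz.
Variables c1 c2 c3 : C.
Hypothesis contraction : forall p0 p1 p2 : C,
  (sqmod (c1 * p0) + sqmod (c2 * p0 + c1 * p1) + sqmod (c3 * p0 + c2 * p1 + c1 * p2)
    <= sqmod p0 + sqmod p1 + sqmod p2)%R.

Let D : R := (1 - sqmod c1)%R.
(** [X / (D^2 - |c2|^2)] is the third Schur parameter of [omega z / z], after [c1] and [c2 / D]. *)
Let X : C := RtoC D * c3 + Cconj c1 * (c2 * c2).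
(** The cross coefficient of the quadratic form in [schwarz_schur]: right side minus left side is
    [E |y|^2 - 2 Re (conj y p B) + k |p|^2], with [E] and [k] as in [schwarz_third]. *)
Let B : C := RtoC D * (Cconj c1 * c2) + Cconj c2 * c3.

Lemma schwarz_sum : (sqmod c1 + sqmod c2 + sqmod c3 <= 1)%R.
Proof.
  assert (H := contraction 1 0 0). revert H. coords. intros H. nra.
Qed.

Lemma schwarz_second : (0 < D)%R -> (sqmod c2 <= D ^ 2)%R.
Proof.
  (* Without the third output coordinate, the form at [p0 = D] is minimal at [p1 = conj c1 c2]. *)
  intros HD. assert (H := contraction (RtoC D) (Cconj c1 * c2) 0).
  assert (P := sqmod_ge_0 (c3 * RtoC D + c2 * (Cconj c1 * c2) + c1 * 0)).
  assert (E : (sqmod (RtoC D) + sqmod (Cconj c1 * c2) + sqmod 0 - sqmod (c1 * RtoC D)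
     - sqmod (c2 * RtoC D + c1 * (Cconj c1 * c2)) = D * (D ^ 2 - sqmod c2))%R).
  { unfold D. coords. ring. }
  assert (0 <= D * (D ^ 2 - sqmod c2))%R by lra. nra.
Qed.

(** A Schur complement: after scaling by [D], the last variable is eliminated at its minimiser
    [Cconj c1 * A], for which the third output coordinate is just [A]. *)
Lemma schwarz_schur (p y : C) : (0 < D)%R ->
  (sqmod (c3 * p + c2 * y) <= D * (D * sqmod p + sqmod y - sqmod (c2 * p + c1 * y)))%R.
Proof.
  intros HD. set (A := c3 * p + c2 * y).
  assert (H := contraction (RtoC D * p) (RtoC D * y) (Cconj c1 * A)).
  assert (E : (sqmod (RtoC D * p) + sqmod (RtoC D * y) + sqmod (Cconj c1 * A) - sqmod (c1 * (RtoC D * p))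
     - sqmod (c2 * (RtoC D * p) + c1 * (RtoC D * y))
     - sqmod (c3 * (RtoC D * p) + c2 * (RtoC D * y) + c1 * (Cconj c1 * A)) =
     D ^ 2 * (D * sqmod p + sqmod y - sqmod (c2 * p + c1 * y)) - D * sqmod A)%R).
  { replace (c3 * (RtoC D * p) + c2 * (RtoC D * y) + c1 * (Cconj c1 * A)) with A.
    - unfold D. generalize A. intros A'. coords. ring.
    - replace (c3 * (RtoC D * p) + c2 * (RtoC D * y)) with (RtoC D * A) by (unfold A; ring).
      unfold D. generalize A. intros A'. apply injective_projections; coords; ring. }
  assert (0 <= D * (D * (D * sqmod p + sqmod y - sqmod (c2 * p + c1 * y)) - sqmod A))%R by nra.
  nra.
Qed.

Lemma schwarz_third : (0 < D)%R -> (sqmod X <= (D ^ 2 - sqmod c2) ^ 2)%R.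
Proof.
  intros HD. assert (H2 := schwarz_second HD).
  set (E := (D ^ 2 - sqmod c2)%R).
  destruct (Rle_lt_or_eq_dec 0 E) as [PE|ZE]; [unfold E; lra| |].
  (* For fixed [p] the form is minimal at [y = p B / E]; [p = E] clears the denominator. *)
  - assert (H := schwarz_schur (RtoC E) B HD).
    assert (I : (D * (D * sqmod (RtoC E) + sqmod B - sqmod (c2 * RtoC E + c1 * B))
       - sqmod (c3 * RtoC E + c2 * B) = E * (E ^ 2 - sqmod X))%R).
    { unfold B, X, E, D. coords. ring. }
    assert (0 <= E * (E ^ 2 - sqmod X))%R by lra. nra.
  (* For [E = 0] the form has no [|y|^2] term. Nonnegativity at [y = s B] for every real [s] forces
     [B = 0], and [c2 B = D X + (|c2|^2 - D^2) c3] then gives [X = 0]. *)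
  - assert (u : sqmod c2 = (D ^ 2)%R) by (unfold E in ZE; lra).
    set (k := (D ^ 2 - D * sqmod c2 - sqmod c3)%R).
    assert (L : forall s : R, (2 * s * sqmod B <= k)%R).
    { intros s. assert (H := schwarz_schur 1 (RtoC s * B) HD).
      assert (I : (D * (D * sqmod 1 + sqmod (RtoC s * B) - sqmod (c2 * 1 + c1 * (RtoC s * B)))
        - sqmod (c3 * 1 + c2 * (RtoC s * B)) =
        k - 2 * s * sqmod B + (D ^ 2 - sqmod c2) * (s ^ 2 * sqmod B))%R).
      { unfold k, B, D. coords. ring. }
      rewrite u in I. nra. }
    assert (ZB : sqmod B = 0%R).
    { destruct (Rle_lt_or_eq_dec 0 (sqmod B) (sqmod_ge_0 B)) as [P|Z]; [|auto].
      assert (T := L ((k + 1) / sqmod B)%R). assert (T0 := L 0%R).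
      replace (2 * ((k + 1) / sqmod B) * sqmod B)%R with (2 * (k + 1))%R in T by (field; lra).
      lra. }
    assert (I : (sqmod c2 * sqmod B = sqmod (RtoC D * X + (RtoC (sqmod c2) - RtoC D * RtoC D) * c3))%R).
    { unfold X, B. generalize D. intros d. coords. ring. }
    replace (RtoC (sqmod c2) - RtoC D * RtoC D) with (RtoC 0) in I.
    2: { rewrite u. apply injective_projections; coords; ring. }
    replace (sqmod (RtoC D * X + 0 * c3)) with (D ^ 2 * sqmod X)%R in I.
    2: { generalize X. intros X'. coords. ring. }
    rewrite ZB in I. rewrite <- ZE. assert (PX := sqmod_ge_0 X).
    assert (0 < D ^ 2)%R by nra. nra.
Qed.

Lemma schwarz_functional_bound :
  (Cmod (3 * (c1 * c3) + c1 * c1 * c2 - c1 * c1 * c1 * c1 / 2 - 2 * (c2 * c2)) <= 2)%R.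
Proof.
  assert (HS := schwarz_sum). assert (P1 := sqmod_ge_0 c1). assert (P2 := sqmod_ge_0 c2).
  assert (P3 := sqmod_ge_0 c3). rewrite !sqmod_Cmod in *.
  assert (T0 := Cmod_ge_0 c1). assert (V0 := Cmod_ge_0 c2).
  assert (D0 : (0 <= D)%R) by (unfold D; rewrite sqmod_Cmod; lra).
  assert (Dt : D = (1 - Cmod c1 ^ 2)%R) by (unfold D; now rewrite sqmod_Cmod).
  destruct (Rle_lt_or_eq_dec 0 D D0) as [HD|ZD].
  - assert (H2 := schwarz_second HD). rewrite sqmod_Cmod in H2.
    assert (Hv : (Cmod c2 <= D)%R) by nra.
    assert (H3 := schwarz_third HD).
    apply Cmod_le_of_sqmod in H3; [|rewrite sqmod_Cmod; nra]. rewrite sqmod_Cmod in H3.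
    (* The factor [D] lets [D c3 = X - conj c1 c2^2] eliminate [c3], after which only moduli
       matter. *)
    assert (I : RtoC D * (3 * (c1 * c3) + c1 * c1 * c2 - c1 * c1 * c1 * c1 / 2 - 2 * (c2 * c2)) =
      3 * (c1 * X) + (- (3) * (RtoC (sqmod c1) * (c2 * c2)) + (RtoC D * (c1 * c1 * c2)
       + (- / 2 * (RtoC D * (c1 * c1 * c1 * c1)) + - (2) * (RtoC D * (c2 * c2)))))).
    { replace (RtoC (sqmod c1)) with (c1 * Cconj c1).
      - unfold X. field.
      - apply injective_projections; coords; ring. }
    set (H := 3 * (c1 * c3) + c1 * c1 * c2 - c1 * c1 * c1 * c1 / 2 - 2 * (c2 * c2)) in *.
    assert (N : (D * Cmod H <= 3 * (Cmod c1 * Cmod X) + (3 * (Cmod c1 ^ 2 * Cmod c2 ^ 2)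
       + (D * (Cmod c1 ^ 2 * Cmod c2) + (/ 2 * (D * Cmod c1 ^ 4) + 2 * (D * Cmod c2 ^ 2)))))%R).
    { replace (D * Cmod H)%R with (Cmod (RtoC D * H)).
      2: { rewrite Cmod_mult, Cmod_R, Rabs_pos_eq; auto. }
      rewrite I.
      assert (AD : Rabs D = D) by now apply Rabs_pos_eq.
      assert (A3 : Cmod (RtoC 3) = 3%R) by (rewrite Cmod_R; apply Rabs_pos_eq; lra).
      assert (A2 : Cmod (RtoC 2) = 2%R) by (rewrite Cmod_R; apply Rabs_pos_eq; lra).
      assert (Ah : Cmod (/ RtoC 2) = (/ 2)%R).
      { rewrite Cmod_inv, A2; [reflexivity|]. intros E. apply RtoC_inj in E. lra. }
      assert (As : Cmod (RtoC (sqmod c1)) = (Cmod c1 ^ 2)%R).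
      { rewrite Cmod_R, Rabs_pos_eq; [apply sqmod_Cmod|apply sqmod_ge_0]. }
      repeat (eapply Rle_trans; [apply Cmod_triangle|]; apply Rplus_le_compat);
      rewrite ?Cmod_mult, ?Cmod_opp, ?As, ?A3, ?A2, ?Ah, ?Cmod_R, ?AD; right; ring. }
    set (t := Cmod c1) in *. set (v := Cmod c2) in *. set (h := Cmod H) in *.
    assert (Tl : (t <= 1)%R) by nra.
    assert (N2 : (3 * (t * Cmod X) <= 3 * (t * (D ^ 2 - v ^ 2)))%R).
    { apply Rmult_le_compat_l; [lra|]. apply Rmult_le_compat_l; lra. }
    (* With [D = 1 - t^2] the coefficient of [v^2] is [(1 - t) (2 - t) >= 0], so the left side
       increases with [v]; at the largest value [v = D] it equals [D (2 - 3/2 t^4)]. *)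
    assert (Q : (3 * (t * (D ^ 2 - v ^ 2)) + (3 * (t ^ 2 * v ^ 2) + (D * (t ^ 2 * v)
       + (/ 2 * (D * t ^ 4) + 2 * (D * v ^ 2)))) <= 2 * D)%R).
    { assert (Q1 : (v ^ 2 * (2 - 3 * t + t ^ 2) <= D ^ 2 * (2 - 3 * t + t ^ 2))%R).
      { apply Rmult_le_compat_r; [|nra]. replace (2 - 3 * t + t ^ 2)%R with ((1 - t) * (2 - t))%R by ring.
        apply Rmult_le_pos; lra. }
      assert (Q2 : (D * (t ^ 2 * v) <= D * (t ^ 2 * D))%R).
      { apply Rmult_le_compat_l; [lra|]. apply Rmult_le_compat_l; [nra|lra]. }
      assert (Q3 : (3 * t * D ^ 2 + D ^ 2 * (2 - 3 * t + t ^ 2) + D * (t ^ 2 * D) + / 2 * (D * t ^ 4)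
        = D * (2 - 3 / 2 * t ^ 4))%R).
      { rewrite Dt. field. }
      assert (Q4 : (2 * D * v ^ 2 + 3 * t ^ 2 * v ^ 2 - 3 * t * v ^ 2 = v ^ 2 * (2 - 3 * t + t ^ 2))%R).
      { rewrite Dt. ring. }
      assert (0 <= D * t ^ 4)%R by (apply Rmult_le_pos; [lra|apply pow_le; lra]).
      lra. }
    assert (D * h <= D * 2)%R by lra. apply Rmult_le_reg_l with D; assumption.
  (* Here [|c1| = 1], so [schwarz_sum] leaves no room for [c2] and [c3], and the functional has
     modulus [1/2]. *)
  - assert (Z2 : c2 = 0) by (apply Cmod_eq_0; nra).
    assert (Z3 : c3 = 0) by (apply Cmod_eq_0; nra).
    rewrite Z2, Z3.
    replace (3 * (c1 * 0) + c1 * c1 * 0 - c1 * c1 * c1 * c1 / 2 - 2 * (0 * 0)) with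
      (c1 * c1 * c1 * c1 * / 2 * - (1)) by (field).
    rewrite !Cmod_mult, Cmod_m1.
    rewrite Cmod_inv, Cmod_R, Rabs_pos_eq; [|lra|intros E; apply RtoC_inj in E; lra].
    assert (T1 : Cmod c1 = 1%R) by nra. rewrite T1. lra.
Qed.
End Toeplitz.

(** * Boundedness near the origin, and passage to radius 1 *)

(** The point [0] is excluded because remainders are quotients by powers of [z], with a default
    value there. *)
Definition bdd0 (F : C -> C) : Prop :=
  exists M d : R, (0 < d)%R /\ forall z, (0 < Cmod z < d)%R -> (Cmod (F z) <= M)%R.

Lemma bdd0_const (c : C) : bdd0 (fun _ => c).
Proof. exists (Cmod c), 1%R. split; [lra|]. intros. lra. Qed.

Lemma bdd0_id : bdd0 (fun z => z).
Proof. exists 1%R, 1%R. split; [lra|]. intros. lra. Qed.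

Lemma bdd0_plus (F G : C -> C) : bdd0 F -> bdd0 G -> bdd0 (fun z => F z + G z).
Proof.
  intros [M [d [Hd HF]]] [N [e [He HG]]]. exists (M + N)%R, (Rmin d e). split; [now apply Rmin_pos|].
  intros z Hz. assert (L1 := Rmin_l d e). assert (L2 := Rmin_r d e).
  eapply Rle_trans; [apply Cmod_triangle|]. apply Rplus_le_compat; [apply HF|apply HG]; lra.
Qed.

Lemma bdd0_mult (F G : C -> C) : bdd0 F -> bdd0 G -> bdd0 (fun z => F z * G z).
Proof.
  intros [M [d [Hd HF]]] [N [e [He HG]]]. exists (M * N)%R, (Rmin d e). split; [now apply Rmin_pos|].
  intros z Hz. assert (L1 := Rmin_l d e). assert (L2 := Rmin_r d e).
  rewrite Cmod_mult. apply Rmult_le_compat; try apply Cmod_ge_0; [apply HF|apply HG]; lra.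
Qed.

Lemma bdd0_ext (F G : C -> C) (e : R) :
  (0 < e)%R -> (forall z, (0 < Cmod z < e)%R -> F z = G z) -> bdd0 F -> bdd0 G.
Proof.
  intros He E [M [d [Hd HF]]]. exists M, (Rmin d e). split; [now apply Rmin_pos|].
  intros z Hz. assert (L1 := Rmin_l d e). assert (L2 := Rmin_r d e).
  rewrite <- E by lra. apply HF. lra.
Qed.

Lemma bdd0_cont (F : C -> C) : ccont F 0 -> bdd0 F.
Proof.
  intros H. rewrite ccont_eps in H. destruct (H (mkposreal 1 Rlt_0_1)) as [d Hd].
  exists (Cmod (F 0%R) + 1)%R, d. split; [apply cond_pos|]. intros z Hz.
  specialize (Hd z). simpl in Hd. replace (z - 0) with z in Hd by ring. specialize (Hd (proj2 Hz)).
  assert (T := Cmod_triangle (F 0%R) (F z - F 0%R)). replace (F 0%R + (F z - F 0%R)) with (F z) in T by ring.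
  lra.
Qed.

Ltac bdd0_tac :=
  lazymatch goal with
  | |- bdd0 (fun _ => ?c) => apply bdd0_const
  | |- bdd0 (fun z => z) => apply bdd0_id
  | |- bdd0 (fun z => Cplus (@?a z) (@?b z)) => apply (bdd0_plus a b); bdd0_tac
  | |- bdd0 (fun z => Cmult (@?a z) (@?b z)) => apply (bdd0_mult a b); bdd0_tac
  | |- _ => try assumption
  end.

Lemma ge_0_at_1 (g : R -> R) :
  continuous g 1%R -> (forall r, (0 < r < 1)%R -> (0 <= g r)%R) -> (0 <= g 1)%R.
Proof.
  intros Hc Hg. destruct (Rle_or_lt 0 (g 1%R)) as [|N]; [assumption|exfalso].
  assert (L : locally 1%R (fun r => (g r < 0)%R)).
  { apply (Hc (fun y => (y < 0)%R)). apply (locally_interval _ _ m_infty 0%R); simpl; auto. }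
  destruct L as [d Hd]. assert (Pd := cond_pos d).
  set (r := (1 - Rmin 1 d / 2)%R).
  assert (M1 := Rmin_l 1 d). assert (M2 := Rmin_r 1 d).
  assert (M3 : (0 < Rmin 1 d)%R) by (apply Rmin_pos; lra).
  assert (B : (g r < 0)%R).
  { apply Hd. change (Rabs (r - 1) < d)%R. rewrite Rabs_left; unfold r; lra. }
  specialize (Hg r). unfold r in *. lra.
Qed.

(** * Comparison of norms on circles *)

Section Contraction.
Variables (omega rem : C -> C) (c1 c2 c3 : C).
Hypothesis omega_hol : hol unit_disk omega.
Hypothesis omega_disk : forall z, unit_disk z -> unit_disk (omega z).
Hypothesis rem_bdd : bdd0 rem.
Hypothesis omega_expansion : forall z : C, z <> 0 ->
  omega z = c1 * z + c2 * (z * z) + c3 * (z * z * z) + z * z * z * z * rem z.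

Section Fixed.
Variables (p0 p1 p2 : C) (r : R).
Hypothesis Hr : (0 < r < 1)%R.
Let q1 := c1 * p0.
Let q2 := c2 * p0 + c1 * p1.
Let q3 := c3 * p0 + c2 * p1 + c1 * p2.
Let s : R := (r * r)%R.
Let p (z : C) : C := p0 + p1 * z + p2 * (z * z).
Let q (z : C) : C := q1 * z + q2 * (z * z) + q3 * (z * z * z).

(* On the circle [|z| = r], where the conjugate of [z] is [s / z], the real part
   of [aux z] is [2 Re ((omega p - q) conj q) + |q|^2 - |p|^2] up to an additive constant. *)
Let qbar (z : C) : C :=
  Cconj q1 * s * (z * z) + Cconj q2 * (s * s) * z + Cconj q3 * (s * s * s).
Let cross (z : C) : C :=
  q2 * Cconj q1 * s * z + q3 * Cconj q1 * s * (z * z) + q3 * Cconj q2 * (s * s) * z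
  - (p1 * Cconj p0 * z + p2 * Cconj p0 * (z * z) + p2 * Cconj p1 * s * z).
Let aux (z : C) : C :=
  2 * ((omega z * p z - q z) * qbar z * / (z * z * z)) + 2 * cross z.

Lemma aux_hol : hol punctured aux.
Proof.
  assert (Ho : hol punctured omega).
  { apply hol_sub with unit_disk; [|exact omega_hol]. intros z [_ H]. exact H. }
  unfold aux, cross, qbar, p, q. hol_tac.
  apply hol_inv; [hol_tac|]. intros z [Hz _].
  apply Cmod_gt_0 in Hz. apply Cmult_neq_0; [apply Cmult_neq_0|]; exact Hz.
Qed.

Lemma aux_small : exists M d : R, (0 < d)%R /\
  forall z, (0 < Cmod z < d)%R -> (Cmod (aux z) <= M * Cmod z)%R.
Proof.
  (* This is [aux z / z]: the terms of [omega p] of degree at most 3 are exactly [q], so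
     [omega p - q] has a factor [z^4], which beats the pole [z^-3]; [cross] has a factor [z] as
     well. *)
  set (g := fun z => 2 * ((rem z * p z + (c2 * p2 + c3 * p1) + c3 * p2 * z) * qbar z)
    + 2 * (q2 * Cconj q1 * s + q3 * Cconj q1 * s * z + q3 * Cconj q2 * (s * s)
     + - (1) * (p1 * Cconj p0 + p2 * Cconj p0 * z + p2 * Cconj p1 * s))).
  assert (G : bdd0 g) by (unfold g, p, qbar; bdd0_tac).
  destruct G as [M [d [Hd HM]]]. exists M, d. split; [exact Hd|]. intros z Hz.
  replace (aux z) with (g z * z).
  - rewrite Cmod_mult. apply Rmult_le_compat_r; [apply Cmod_ge_0|auto].
  - assert (N : z <> 0) by (apply Cmod_gt_0; lra).
    unfold aux, g. rewrite omega_expansion by exact N.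
    unfold q, p, cross, q1, q2, q3. generalize (qbar z), (rem z). intros. field. exact N.
Qed.

(** Expand [|omega p|^2] around [q], drop [|omega p - q|^2] and use [|omega| <= 1]. [cross] carries
    the off-diagonal terms of [|q|^2 - |p|^2], so only the diagonal ones survive on the right. *)
Lemma aux_bound (z : C) : Cmod z = r -> (Re (aux z) <=
  sqmod p0 + sqmod p1 * s + sqmod p2 * s ^ 2 - (sqmod q1 * s + sqmod q2 * s ^ 2 + sqmod q3 * s ^ 3))%R.
Proof.
  intros Hz.
  assert (N : z <> 0) by (apply Cmod_gt_0; lra).
  assert (Ds : unit_disk z) by (unfold unit_disk; lra).
  assert (Ez : RtoC s = z * Cconj z).
  { rewrite <- Cmod2_conj, Hz. f_equal. unfold s. ring. }
  assert (Eq : qbar z * / (z * z * z) = Cconj (q z)).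
  { unfold qbar, q. rewrite !Cplus_conj, !Cmult_conj, Ez. field. exact N. }
  unfold aux.
  replace ((omega z * p z - q z) * qbar z * / (z * z * z)) with ((omega z * p z - q z) * Cconj (q z)).
  2: { rewrite <- Eq. ring. }
  assert (E1 : (sqmod (p z) - sqmod (q z) + 2 * Re (cross z) =
     sqmod p0 + sqmod p1 * s + sqmod p2 * s ^ 2 - (sqmod q1 * s + sqmod q2 * s ^ 2 + sqmod q3 * s ^ 3))%R).
  { assert (Es : s = (Re z ^ 2 + Im z ^ 2)%R) by (rewrite <- Cmod2_alt, Hz; unfold s; ring).
    unfold p, q, cross. rewrite Es. generalize q1 q2 q3. clear. intros u1 u2 u3.
    destruct z as [x y], u1 as [a1 b1], u2 as [a2 b2], u3 as [a3 b3], p0 as [e0 f0], p1 as [e1 f1], p2 as [e2 f2].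
    coords. ring. }
  assert (E2 : (Re (2 * ((omega z * p z - q z) * Cconj (q z)) + 2 * cross z) =
    sqmod (omega z) * sqmod (p z) - sqmod (omega z * p z - q z) - sqmod (q z) + 2 * Re (cross z))%R).
  { generalize (omega z) (p z) (q z) (cross z). intros [a b] [a' b'] [a'' b''] [x y]. coords. ring. }
  rewrite E2, <- E1.
  assert (P1 := sqmod_ge_0 (omega z * p z - q z)). assert (P2 := sqmod_ge_0 (p z)).
  assert (O : (sqmod (omega z) <= 1)%R).
  { rewrite sqmod_Cmod. assert (T := omega_disk z Ds). unfold unit_disk in T.
    assert (T' := Cmod_ge_0 (omega z)). nra. }
  nra.
Qed.

Lemma contraction_radius :
  (0 <= sqmod p0 + sqmod p1 * s + sqmod p2 * s ^ 2 - (sqmod q1 * s + sqmod q2 * s ^ 2 + sqmod q3 * s ^ 3))%R.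
Proof.
  destruct aux_small as [M [d [Hd HM]]]. destruct aux_hol as [aux' HA].
  exact (circle_bound aux aux' HA M d r _ Hd HM Hr aux_bound).
Qed.
End Fixed.

(* Comparison of [L^2] norms on circles: [omega p] has [q] as its Taylor polynomial
   of degree [3] and is dominated by [p]. *)
Lemma toeplitz_contraction (p0 p1 p2 : C) :
  (sqmod (c1 * p0) + sqmod (c2 * p0 + c1 * p1) + sqmod (c3 * p0 + c2 * p1 + c1 * p2)
    <= sqmod p0 + sqmod p1 + sqmod p2)%R.
Proof.
  set (g := fun r : R => (sqmod p0 + sqmod p1 * (r * r) + sqmod p2 * (r * r) ^ 2
    - (sqmod (c1 * p0) * (r * r) + sqmod (c2 * p0 + c1 * p1) * (r * r) ^ 2
     + sqmod (c3 * p0 + c2 * p1 + c1 * p2) * (r * r) ^ 3))%R).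
  (* Only radii below 1 are available; continuity carries the inequality to the limit. *)
  assert (G : (0 <= g 1)%R).
  { apply ge_0_at_1.
    - apply (ex_derive_continuous g). unfold g. auto_derive. exact I.
    - intros r Hr. exact (contraction_radius p0 p1 p2 r Hr). }
  unfold g in G. lra.
Qed.
End Contraction.

(** * Local derivatives and shifts of power series *)

Lemma unit_disk_locally (z : C) : unit_disk z -> @locally Cfield z unit_disk.
Proof.
  intros H. apply locally_cball. unfold unit_disk in *.
  assert (P : (0 < 1 - Cmod z)%R) by lra. exists (mkposreal _ P). simpl. intros w Hw.
  assert (T := Cmod_triangle z (w - z)). replace (z + (w - z)) with w in T by ring. lra.
Qed.

Lemma cderiv_ext_disk (F G : C -> C) (z l : C) :
  (forall w, unit_disk w -> F w = G w) -> unit_disk z -> cderiv F z l -> cderiv G z l.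
Proof.
  intros E Hz. apply (@is_derive_ext_loc C_AbsRing Cfield).
  generalize (unit_disk_locally z Hz). apply filter_imp. exact E.
Qed.

Lemma cderiv_eq (F : C -> C) (z l m : C) : cderiv F z l -> l = m -> cderiv F z m.
Proof. intros H <-. exact H. Qed.

Ltac cderiv_tac :=
  lazymatch goal with
  | |- cderiv (fun _ => ?c) _ _ => apply cderiv_const
  | |- cderiv (fun z => z) _ _ => apply cderiv_id
  | |- cderiv (fun z => Cplus (@?a z) (@?b z)) _ _ => eapply (cderiv_plus a b); cderiv_tac
  | |- cderiv (fun z => Cminus (@?a z) (@?b z)) _ _ => eapply (cderiv_minus a b); cderiv_tac
  | |- cderiv (fun z => Cmult (@?a z) (@?b z)) _ _ => eapply (cderiv_mult a b); cderiv_tac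
  | |- _ => try eassumption
  end.

Notation Cseries u l := (@is_series C_AbsRing C_NormedModule u l).

Lemma Cseries_unique (u : nat -> C) (l m : C) : Cseries u l -> Cseries u m -> l = m.
Proof. exact (@filterlim_locally_unique nat C_AbsRing C_NormedModule eventually _ _ l m). Qed.

Lemma Cseries_at_0 (b : nat -> C) : Cseries (fun k => b k * 0 ^ k) (b 0%nat).
Proof.
  apply is_series_decr_1.
  match goal with |- is_series _ ?x => replace x with (RtoC 0) end.
  2: { change (@eq C 0 (b 0%nat + - (b 0%nat * 1))). ring. }
  apply (is_series_ext (fun _ => RtoC 0)).
  { intros k. rewrite Cpow_S. match goal with |- ?x = ?y => change (@eq C x y) end. ring. }
  unfold is_series. apply (filterlim_ext (fun _ => RtoC 0)); [|apply filterlim_const].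
  intros n. induction n as [|n IH]; [now rewrite sum_O|].
  rewrite sum_Sn, <- IH. change (@eq C 0 (0 + 0)). ring.
Qed.

Lemma unit_disk_0 : unit_disk 0.
Proof. unfold unit_disk. rewrite Cmod_0. lra. Qed.

Lemma psum_shift (b : nat -> C) (F : C -> C) : psum b F ->
  exists G, psum (fun k => b (S k)) G /\ forall z, unit_disk z -> F z = b 0%nat + z * G z.
Proof.
  (* The value at [0] fills the removable singularity of the quotient. *)
  intros H. exists (fun z => if Ceq_dec z 0 then b 1%nat else (F z - b 0%nat) / z).
  assert (F0 : F 0 = b 0%nat) by exact (Cseries_unique _ _ _ (H 0 unit_disk_0) (Cseries_at_0 b)).
  split; intros z Hz; destruct (Ceq_dec z 0) as [->|N].
  - exact (Cseries_at_0 (fun k => b (S k))).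
  - assert (S1 : Cseries (fun k => b (S k) * z ^ S k) (F z - b 0%nat)).
    { apply (is_series_incr_1 (fun k => b k * z ^ k)).
      match goal with |- is_series _ ?x => replace x with (F z) end; [exact (H z Hz)|].
      change (@eq C (F z) (F z - b 0%nat + b 0%nat * 1)). ring. }
    apply (is_series_scal (/ z)) in S1.
    match type of S1 with is_series _ ?x => replace ((F z - b 0%nat) / z) with x by apply Cmult_comm end.
    refine (is_series_ext _ _ _ _ S1). intros k.
    change (/ z * (b (S k) * z ^ S k) = b (S k) * z ^ k). rewrite Cpow_S. field. exact N.
  - rewrite F0. ring.
  - field. exact N.
Qed.

Lemma expansion_psum (f : C -> C) (a : nat -> C) : has_expansion f a ->
  psum (fun k => match k with 0%nat => 0 | 1%nat => 1 | _ => a k end) f.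
Proof.
  intros H z Hz. apply (is_series_decr_n _ 2); [lia|].
  match goal with |- is_series _ ?x => replace x with (f z - z) end.
  - refine (is_series_ext _ _ _ _ (H z Hz)). intros k.
    replace (k + 2)%nat with (S (S k)) by lia. reflexivity.
  - simpl. rewrite sum_Sn, sum_O. change (@eq C (f z - z) (f z + - (0 * 1 + 1 * (z * 1)))). ring.
Qed.

Lemma RtoC_neq (x y : R) : x <> y -> RtoC x <> RtoC y.
Proof. intros N E. now apply N, RtoC_inj. Qed.

(** * Expansion of the subordinating function and the upper bound *)

Section UpperBound.
Variables (f omega : C -> C) (a : nat -> C).
Hypothesis f_expansion : has_expansion f a.
Hypothesis f'_neq_0 : forall z, unit_disk z -> C_derive f z <> 0.
Hypothesis omega_analytic : analytic_in_disk omega.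
Hypothesis omega_disk : forall z, unit_disk z -> unit_disk (omega z).
Hypothesis omega_0 : omega 0 = 0.
Hypothesis omega_eq : forall z, unit_disk z ->
  1 + z * C_derive (C_derive f) z / C_derive f z = phi (omega z).

Let a2 := a 2%nat.
Let a3 := a 3%nat.
Let a4 := a 4%nat.
(** The coefficient equations solved for [omega]: that these are its Taylor coefficients is the
    content of [omega_remainder]. *)
Let c1 := 2 * a2.
Let c2 := 6 * a3 - 5 * (a2 * a2).
Let c3 := 12 * a4 - 24 * (a2 * a3) + 13 * (a2 * a2 * a2).

Lemma cderiv_omega (z : C) : unit_disk z -> cderiv omega z (C_derive omega z).
Proof.
  intros Hz. destruct (omega_analytic z Hz) as [l Hl]. apply cderiv_C_NormedModule in Hl.
  now rewrite (cderiv_C_derive _ _ _ Hl).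
Qed.

Lemma one_plus_half_neq_0 (w : C) : unit_disk w -> 1 + w / 2 <> 0.
Proof.
  intros H E. assert (W : w = - (2)).
  { replace w with (2 * (1 + w / 2) - 2) by field. rewrite E. ring. }
  unfold unit_disk in H. rewrite W, Cmod_opp, Cmod_R, Rabs_pos_eq in H; lra.
Qed.

(* [(1 + omega / 2)^2] has a continuous derivative, hence so has [omega]. *)
Lemma omega_hol : hol unit_disk omega.
Proof.
  assert (P := expansion_psum _ _ f_expansion).
  destruct (psum_C_derive _ _ P) as [P1 _]. destruct (psum_C_derive _ _ P1) as [P2 _].
  assert (H : hol unit_disk (fun z => 1 + z * C_derive (C_derive f) z * / C_derive f z)).
  { apply psum_hol in P1, P2.
    apply hol_plus; [apply hol_const|]. apply hol_mult; [|now apply hol_inv].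
    apply hol_mult; [apply hol_id|assumption]. }
  destruct H as [h' H].
  exists (fun z => h' z * / (1 + omega z * / 2)). intros z Hz. destruct (H z Hz) as [H1 H2].
  assert (N := one_plus_half_neq_0 _ (omega_disk z Hz)).
  assert (D := cderiv_omega z Hz).
  split.
  - apply (cderiv_eq _ _ _ _ D).
    assert (D2 : cderiv (fun z => (1 + omega z * / 2) * (1 + omega z * / 2)) z
      ((1 + omega z * / 2) * C_derive omega z)).
    { eapply cderiv_eq; [cderiv_tac|]. cbv beta. field. }
    assert (E : forall w, unit_disk w ->
      1 + w * C_derive (C_derive f) w * / C_derive f w = (1 + omega w * / 2) * (1 + omega w * / 2)).
    { intros w Hw. transitivity (phi (omega w)); [exact (omega_eq w Hw)|].
      unfold phi, Cdiv. simpl. ring. }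
    assert (D3 := cderiv_ext_disk _ _ _ _ E Hz H1).
    rewrite (cderiv_unique _ _ _ _ D3 D2).
    change (1 + omega z * / 2 <> 0) in N. revert N. generalize (1 + omega z * / 2). intros x N.
    field. exact N.
  - apply ccont_mult; [exact H2|]. apply ccont_inv; [|exact N].
    apply ccont_plus; [apply ccont_const|].
    apply ccont_mult; [exact (cderiv_cont _ _ _ D)|apply ccont_const].
Qed.

(** Five shifts give [f] as its Taylor polynomial of degree 4 plus [z^5 G], where [G] is again a
    power series; differentiating keeps the remainders explicit and continuous at [0]. *)
Lemma f_derivatives : exists G G' G'' : C -> C,
  ccont G 0 /\ ccont G' 0 /\ ccont G'' 0 /\
  (forall z, unit_disk z -> C_derive f z =
     1 + 2 * a2 * z + 3 * a3 * (z * z) + 4 * a4 * (z * z * z) + z * z * z * z * (5 * G z + z * G' z)) /\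
  (forall z, unit_disk z -> C_derive (C_derive f) z =
     2 * a2 + 6 * a3 * z + 12 * a4 * (z * z) + z * z * z * (20 * G z + 10 * z * G' z + z * z * G'' z)).
Proof.
  assert (P := expansion_psum _ _ f_expansion).
  destruct (psum_shift _ _ P) as [g1 [P1 E1]]. destruct (psum_shift _ _ P1) as [g2 [P2 E2]].
  destruct (psum_shift _ _ P2) as [g3 [P3 E3]]. destruct (psum_shift _ _ P3) as [g4 [P4 E4]].
  destruct (psum_shift _ _ P4) as [G [PG E5]]. cbv beta iota in *.
  destruct (psum_C_derive _ _ PG) as [PG1 D0]. destruct (psum_C_derive _ _ PG1) as [PG2 D1].
  destruct (psum_C_derive _ _ PG2) as [_ D2].
  exists G, (C_derive G), (C_derive (C_derive G)).
  assert (Ef : forall z, unit_disk z -> z + a2 * (z * z) + a3 * (z * z * z) + a4 * (z * z * z * z)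
     + z * z * z * z * z * G z = f z).
  { intros z Hz. rewrite E1, E2, E3, E4, E5 by exact Hz. unfold a2, a3, a4. ring. }
  assert (F1 : forall z, unit_disk z -> C_derive f z =
     1 + 2 * a2 * z + 3 * a3 * (z * z) + 4 * a4 * (z * z * z) + z * z * z * z * (5 * G z + z * C_derive G z)).
  { intros z Hz. apply cderiv_C_derive. apply (cderiv_ext_disk _ _ _ _ Ef Hz).
    assert (D := D0 z Hz). eapply cderiv_eq; [cderiv_tac|]. cbv beta. ring. }
  repeat split; try (eapply cderiv_cont; eauto using unit_disk_0); [exact F1|].
  intros z Hz. apply cderiv_C_derive.
  apply (cderiv_ext_disk _ _ _ _ (fun w Hw => eq_sym (F1 w Hw)) Hz).
  assert (D := D0 z Hz). assert (D' := D1 z Hz). eapply cderiv_eq; [cderiv_tac|]. cbv beta. ring.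
Qed.

(** The cubic polynomial [W] solves the quadratic equation of [omega] up to [z^4 K]. Subtracting the
    two equations leaves [omega - W] times a factor that tends to 1, so the remainder is bounded
    without any Taylor theorem for [omega]. *)
Lemma omega_remainder : exists rem, bdd0 rem /\ forall z : C, z <> 0 ->
  omega z = c1 * z + c2 * (z * z) + c3 * (z * z * z) + z * z * z * z * rem z.
Proof.
  destruct f_derivatives as [G [G' [G'' [CG [CG' [CG'' [F1 F2]]]]]]].
  set (W := fun z => c1 * z + c2 * (z * z) + c3 * (z * z * z)).
  exists (fun z => (omega z - W z) / (z * z * z * z)). split.
  2: { intros z Hz. unfold W. field. exact Hz. }
  (* [W + W^2 / 4 = p1 z + p2 z^2 + p3 z^3 + z^4 P4 z]. *)
  set (p1 := c1). set (p2 := c2 + c1 * c1 / 4). set (p3 := c3 + c1 * c2 / 2).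
  set (P4 := fun z => (c2 * c2 + 2 * c1 * c3) / 4 + c2 * c3 / 2 * z + c3 * c3 / 4 * (z * z)).
  (* [z f'' - f' (W + W^2 / 4) = z^4 K z], by the choice of [c1], [c2], [c3]. *)
  set (K := fun z => (20 * G z + 10 * z * G' z + z * z * G'' z)
     - (P4 z + 2 * a2 * (p3 + z * P4 z) + 3 * a3 * (p2 + p3 * z + z * z * P4 z)
       + 4 * a4 * (p1 + p2 * z + p3 * (z * z) + z * z * z * P4 z)
       + z * (5 * G z + z * G' z) * (p1 + p2 * z + p3 * (z * z) + z * z * z * P4 z))).
  (* [f'] times the divided difference of [x + x^2 / 4] between [omega z] and [W z]. *)
  set (den := fun z => (1 + 2 * a2 * z + 3 * a3 * (z * z) + 4 * a4 * (z * z * z)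
    + z * z * z * z * (5 * G z + z * G' z)) * (1 + / 4 * (omega z + W z))).
  assert (CO : ccont omega 0) by exact (cderiv_cont _ _ _ (cderiv_omega 0 unit_disk_0)).
  assert (CI : ccont (fun z => z) 0) by exact (cderiv_cont _ _ _ (cderiv_id 0)).
  assert (CD : ccont den 0).
  { unfold den, W. ccont_tac. }
  assert (D1 : den 0 = 1).
  { unfold den, W. rewrite omega_0. ring. }
  assert (CK : ccont K 0).
  { unfold K, P4. ccont_tac. }
  assert (CD' := proj1 (ccont_eps den 0) CD (mkposreal 1 Rlt_0_1)).
  destruct CD' as [d Hd]. simpl in Hd.
  apply (bdd0_ext (fun z => K z * / den z) _ (Rmin d 1)).
  - apply Rmin_pos; [apply cond_pos|lra].
  - intros z Hz. assert (L1 := Rmin_l d 1). assert (L2 := Rmin_r d 1).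
    assert (N : z <> 0) by (apply Cmod_gt_0; lra).
    assert (Dz : unit_disk z) by (unfold unit_disk; lra).
    assert (ND : den z <> 0).
    { intros E. specialize (Hd z). rewrite E, D1 in Hd.
      replace (z - 0) with z in Hd by ring. replace (0 - 1) with (- (1)) in Hd by ring.
      rewrite Cmod_m1 in Hd. specialize (Hd ltac:(lra)). lra. }
    assert (EQ : (omega z - W z) * den z = z * z * z * z * K z).
    { assert (O : z * C_derive (C_derive f) z = C_derive f z * (omega z + omega z * omega z / 4)).
      { assert (Q := omega_eq z Dz). assert (NF := f'_neq_0 z Dz).
        replace (z * C_derive (C_derive f) z) with
          (C_derive f z * (1 + z * C_derive (C_derive f) z / C_derive f z - 1)) by (field; exact NF).
        rewrite Q. unfold phi. simpl. field. }
      rewrite F1, F2 in O by exact Dz.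
      transitivity ((1 + 2 * a2 * z + 3 * a3 * (z * z) + 4 * a4 * (z * z * z)
        + z * z * z * z * (5 * G z + z * G' z)) * (omega z + omega z * omega z / 4)
        - (1 + 2 * a2 * z + 3 * a3 * (z * z) + 4 * a4 * (z * z * z)
        + z * z * z * z * (5 * G z + z * G' z)) * (W z + W z * W z / 4)).
      - unfold den. field.
      - rewrite <- O. unfold K, P4, W, p1, p2, p3, c1, c2, c3.
        generalize (G z) (G' z) (G'' z). intros. field. }
    replace (omega z - W z) with (z * z * z * z * K z * / den z).
    + field. auto.
    + rewrite <- EQ. field. exact ND.
  - apply bdd0_cont. apply ccont_mult; [exact CK|]. apply ccont_inv; [exact CD|].
    rewrite D1. apply RtoC_neq. lra.
Qed.

Lemma hankel_bound : (Cmod (hankel_2_2 a) <= 1 / 36)%R.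
Proof.
  destruct omega_remainder as [rem [B E]].
  assert (T := schwarz_functional_bound c1 c2 c3
    (toeplitz_contraction omega rem c1 c2 c3 omega_hol omega_disk B E)).
  replace (3 * (c1 * c3) + c1 * c1 * c2 - c1 * c1 * c1 * c1 / 2 - 2 * (c2 * c2))
    with (RtoC 72 * hankel_2_2 a) in T.
  - rewrite Cmod_mult, Cmod_R, Rabs_pos_eq in T by lra. lra.
  - unfold hankel_2_2, c1, c2, c3, a2, a3, a4. simpl. field.
Qed.
End UpperBound.

(** * The extremal function *)

Lemma psum_exists (b : nat -> C) : (forall k, (Cmod (b k) <= 1)%R) -> exists F, psum b F.
Proof.
  intros H. apply (functional_choice (fun z l => unit_disk z -> Cseries (fun k => b k * z ^ k) l)).
  intros z. destruct (Rlt_or_le (Cmod z) 1) as [Hz|Hz].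
  - assert (E : @ex_series C_AbsRing C_CompleteNormedModule (fun k => b k * z ^ k)).
    { apply (ex_series_le _ (fun k => Cmod z ^ k)%R).
      - intros k. change (Cmod (b k * z ^ k) <= Cmod z ^ k)%R. rewrite Cmod_mult, Cmod_pow.
        rewrite <- (Rmult_1_l (Cmod z ^ k)) at 2. apply Rmult_le_compat_r; [|apply H].
        apply pow_le, Cmod_ge_0.
      - exists (/ (1 - Cmod z))%R. apply is_series_geom. rewrite Rabs_pos_eq; [exact Hz|apply Cmod_ge_0]. }
    destruct E as [l Hl]. exists l. intros _. exact Hl.
  - exists (RtoC 0). unfold unit_disk. intros Hz'. lra.
Qed.

Lemma Cseries_delay (b x : nat -> C) (z l : C) :
  x 0%nat = 0 -> (forall k, x (S k) = b k) ->
  Cseries (fun k => b k * z ^ k) l -> Cseries (fun k => x k * z ^ k) (z * l).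
Proof.
  intros H0 HS H. apply is_series_decr_1.
  match goal with |- is_series _ ?y => replace y with (z * l) end.
  2: { change (@eq C (z * l) (z * l + - (x 0%nat * 1))). rewrite H0. ring. }
  refine (is_series_ext _ _ _ _ (is_series_scal z _ _ H)). intros k.
  change (@eq C (z * (b k * z ^ k)) (x (S k) * z ^ S k)). rewrite HS, Cpow_S. ring.
Qed.

(** The real part is constant along the segment from [0] to [z]; applying this to [- Ci * u] gives
    the imaginary part. *)
Lemma cderiv_0_const (u : C -> C) (z : C) :
  (forall w, unit_disk w -> cderiv u w 0) -> unit_disk z -> u z = u 0.
Proof.
  intros H Hz.
  assert (K : forall v : C -> C, (forall w, unit_disk w -> cderiv v w 0) -> Re (v z) = Re (v 0)).
  { intros v Hv.
    assert (E := eq_is_derive (V := R_NormedModule) (fun t => Re (v (t * Re z, t * Im z)%R)) 0 1).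
    assert (E1 : Re (v (1 * Re z, 1 * Im z)%R) = Re (v z)).
    { rewrite !Rmult_1_l. now destruct z. }
    assert (E0 : Re (v (0 * Re z, 0 * Im z)%R) = Re (v 0)).
    { rewrite !Rmult_0_l. reflexivity. }
    rewrite <- E1, <- E0. symmetry. apply E; [|lra]. intros t Ht.
    assert (Dt : unit_disk (t * Re z, t * Im z)%R).
    { replace ((t * Re z)%R, (t * Im z)%R) with (RtoC t * z).
      - unfold unit_disk in *. rewrite Cmod_mult, Cmod_R, Rabs_pos_eq by lra.
        assert (T := Cmod_ge_0 z). nra.
      - apply injective_projections; coords; ring. }
    assert (Dx : is_derive (fun t => t * Re z)%R t (Re z)) by (auto_derive; auto; ring).
    assert (Dy : is_derive (fun t => t * Im z)%R t (Im z)) by (auto_derive; auto; ring).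
    assert (D := is_derive_Re_comp v _ _ t _ _ _ (Hv _ Dt) Dx Dy).
    replace (Re (0 * (Re z, Im z))) with (zero : R_NormedModule) in D; [exact D|].
    change (@eq R 0%R (0 * Re z - 0 * Im z)%R). ring. }
  assert (K1 := K u H).
  assert (K2 : Re (- Ci * u z) = Re (- Ci * u 0)).
  { apply (K (fun w => - Ci * u w)). intros w Hw. assert (D := H w Hw).
    eapply cderiv_eq; [cderiv_tac|]. cbv beta. ring. }
  apply injective_projections; [exact K1|].
  assert (I : forall w : C, Im w = Re (- Ci * w)) by (intros w; unfold Ci; coords; ring).
  change (Im (u z) = Im (u 0)). rewrite !I. exact K2.
Qed.

Section GaussCoef.
Variable s : R.
Hypothesis Hs : (Rabs s <= 1)%R.

(* [(b_n, b_(n-1), b_(n-2), b_(n-3))] for the Taylor coefficients [b_n] of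
   [exp (s (z^2 / 2 + z^4 / 16))], the solution of [F' = s (z + z^3 / 4) F], [F 0 = 1]. *)
Fixpoint gauss_state (n : nat) : R * R * R * R :=
  match n with
  | O => (1, 0, 0, 0)%R
  | S m => let '(w, x, y, v) := gauss_state m in (s * (x + v / 4) / INR (S m), w, x, y)%R
  end.

Definition gauss_coef (n : nat) : R := let '(w, _, _, _) := gauss_state n in w.

Lemma gauss_state_bound (n : nat) :
  let '(w, x, y, v) := gauss_state n in
  (Rabs w <= 1 /\ Rabs x <= 1 /\ Rabs y <= 1 /\ Rabs v <= 1)%R.
Proof.
  induction n as [|n IH].
  - simpl. rewrite Rabs_R1, Rabs_R0. repeat split; lra.
  (* The estimate [|x + v / 4| <= 2] needs a divisor of at least 2. The first step divides by 1
     only, but there [x] and [v] vanish. *)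
  - destruct n as [|n].
    + simpl. rewrite Rabs_R1, Rabs_R0. replace (s * (0 + 0 / 4) / 1)%R with 0%R by field.
      rewrite Rabs_R0. repeat split; lra.
    + remember (S n) as m. cbn [gauss_state]. destruct (gauss_state m) as [[[w x] y] v].
      destruct IH as [Hw [Hx [Hy Hv]]]. repeat split; auto.
      assert (Pm : (2 <= INR (S m))%R).
      { rewrite S_INR. subst m. rewrite S_INR. assert (T := pos_INR n). lra. }
      change (s * (x + v / 4) / INR (S m))%R with (s * (x + v / 4) * / INR (S m))%R.
      rewrite !Rabs_mult, (Rabs_pos_eq (/ INR (S m))).
      2: { left. apply Rinv_0_lt_compat. lra. }
      assert (T : (Rabs (x + v / 4) <= 2)%R).
      { eapply Rle_trans; [apply Rabs_triang|]. unfold Rdiv. rewrite Rabs_mult, (Rabs_pos_eq (/ 4)) by lra. lra. }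
      apply Rmult_le_reg_r with (INR (S m)); [lra|].
      rewrite Rmult_assoc, Rinv_l, Rmult_1_r, Rmult_1_l by lra.
      assert (T1 := Rabs_pos s). assert (T2 := Rabs_pos (x + v / 4)). nra.
Qed.

Lemma gauss_coef_bound (n : nat) : (Cmod (RtoC (gauss_coef n)) <= 1)%R.
Proof.
  rewrite Cmod_R. assert (T := gauss_state_bound n). unfold gauss_coef.
  destruct (gauss_state n) as [[[w x] y] v]. apply T.
Qed.

Lemma gauss_ode (F : C -> C) : psum (fun n => RtoC (gauss_coef n)) F ->
  (F 0 = 1) /\ forall z, unit_disk z -> C_derive F z = s * (z + z * z * z / 4) * F z.
Proof.
  intros P. split.
  { exact (Cseries_unique _ _ _ (P 0 unit_disk_0) (Cseries_at_0 (fun n => RtoC (gauss_coef n)))). }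
  intros z Hz. destruct (psum_C_derive _ _ P) as [P' _].
  (* [x], [y], [v] are the coefficients of [z F], [z^2 F], [z^3 F], so the recursion
     [n b_n = s (b_(n-2) + b_(n-4) / 4)] is the differential equation read termwise. *)
  set (x n := RtoC (let '(_, x, _, _) := gauss_state n in x)).
  set (y n := RtoC (let '(_, _, y, _) := gauss_state n in y)).
  set (v n := RtoC (let '(_, _, _, v) := gauss_state n in v)).
  assert (Sx : Cseries (fun k => x k * z ^ k) (z * F z)).
  { apply (Cseries_delay (fun n => RtoC (gauss_coef n))); [reflexivity| |exact (P z Hz)].
    intros k. unfold x, gauss_coef. simpl. now destruct (gauss_state k) as [[[? ?] ?] ?]. }
  assert (Sy : Cseries (fun k => y k * z ^ k) (z * (z * F z))).
  { apply (Cseries_delay x); [reflexivity| |exact Sx].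
    intros k. unfold x, y. simpl. now destruct (gauss_state k) as [[[? ?] ?] ?]. }
  assert (Sv : Cseries (fun k => v k * z ^ k) (z * (z * (z * F z)))).
  { apply (Cseries_delay y); [reflexivity| |exact Sy].
    intros k. unfold v, y. simpl. now destruct (gauss_state k) as [[[? ?] ?] ?]. }
  assert (S := is_series_scal (RtoC s) _ _ (is_series_plus _ _ _ _ Sx (is_series_scal (/ 4) _ _ Sv))).
  replace (s * (z + z * z * z / 4) * F z) with (s * (z * F z + / 4 * (z * (z * (z * F z))))) by field.
  refine (Cseries_unique _ _ _ (P' z Hz) _). refine (is_series_ext _ _ _ _ S). intros k.
  change (@eq C (RtoC s * (x k * z ^ k + / 4 * (v k * z ^ k))) (RtoC (INR (Datatypes.S k)) * RtoC (gauss_coef (Datatypes.S k)) * z ^ k)).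
  unfold x, v, gauss_coef. cbn [gauss_state]. destruct (gauss_state k) as [[[w' x'] y'] v'].
  assert (N : INR (Datatypes.S k) <> 0%R) by (apply not_0_INR; lia).
  rewrite RtoC_div by exact N. rewrite RtoC_mult, RtoC_plus, RtoC_div by lra. field.
  apply RtoC_neq. exact N.
Qed.
End GaussCoef.

Definition extremal_coef (n : nat) : C :=
  match n with O => 0 | S k => RtoC (gauss_coef 1 k) / RtoC (INR (S k)) end.

Lemma extremal_coef_bound (n : nat) : (Cmod (extremal_coef n) <= 1)%R.
Proof.
  destruct n as [|n].
  - simpl. rewrite Cmod_0. lra.
  - unfold extremal_coef. assert (P : (1 <= INR (S n))%R).
    { rewrite S_INR. assert (T := pos_INR n). lra. }
    rewrite Cmod_div by (apply RtoC_neq; lra). rewrite (Cmod_R (INR _)), Rabs_pos_eq by lra.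
    assert (T := gauss_coef_bound 1 ltac:(rewrite Rabs_R1; lra) n).
    apply Rmult_le_reg_r with (INR (S n)); [lra|]. unfold Rdiv.
    rewrite Rmult_assoc, Rinv_l, Rmult_1_r by lra. lra.
Qed.

(* The extremal function has [f' = exp (z^2 / 2 + z^4 / 16)], i.e. [omega z = z^2];
   the reciprocal series shows that [f'] has no zero. *)
Lemma extremal_exists : exists (f : C -> C) (a : nat -> C),
  class_C phi f /\ has_expansion f a /\ Cmod (hankel_2_2 a) = (1 / 36)%R.
Proof.
  destruct (psum_exists _ extremal_coef_bound) as [f P].
  destruct (psum_exists _ (gauss_coef_bound (-1) ltac:(rewrite Rabs_left; lra))) as [g Pg].
  destruct (psum_C_derive _ _ P) as [P1 D1].
  assert (P1' : psum (fun n => RtoC (gauss_coef 1 n)) (C_derive f)).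
  { intros z Hz. refine (is_series_ext _ _ _ _ (P1 z Hz)). intros k.
    match goal with |- ?x = ?y => change (@eq C x y) end. unfold extremal_coef.
    field. apply RtoC_neq, not_0_INR. lia. }
  destruct (gauss_ode _ _ P1') as [F0 F1]. destruct (gauss_ode _ _ Pg) as [G0 G1].
  destruct (psum_C_derive _ _ P1) as [_ D2]. destruct (psum_C_derive _ _ Pg) as [_ Dg].
  assert (U : forall z, unit_disk z -> C_derive f z * g z = 1).
  { intros z Hz. rewrite (cderiv_0_const (fun z => C_derive f z * g z) z); [rewrite F0, G0; ring| |exact Hz].
    intros w Hw. assert (E1 := D2 w Hw). assert (E2 := Dg w Hw).
    eapply cderiv_eq; [cderiv_tac|]. cbv beta. rewrite F1, G1 by exact Hw.
    field. }
  assert (N : forall z, unit_disk z -> C_derive f z <> 0).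
  { intros z Hz E. assert (T := U z Hz). rewrite E, Cmult_0_l in T. apply RtoC_inj in T. lra. }
  exists f, extremal_coef. repeat split.
  - intros z Hz. exists (C_derive f z). apply cderiv_C_NormedModule, D1, Hz.
  - exact (Cseries_unique _ _ _ (P 0 unit_disk_0) (Cseries_at_0 extremal_coef)).
  - exact F0.
  - exact N.
  - exists (fun z => z * z). repeat split.
    + intros z _. exists (1 * z + z * 1). apply cderiv_C_NormedModule. cderiv_tac.
    + intros z Hz. unfold unit_disk in *. rewrite Cmod_mult. assert (T := Cmod_ge_0 z). nra.
    + ring.
    + intros z Hz. rewrite F1 by exact Hz. unfold phi. simpl. field. exact (N z Hz).
  - intros z Hz.
    assert (T := is_series_incr_n (fun k => extremal_coef k * z ^ k) 2 (f z - z) ltac:(lia)).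
    refine (is_series_ext _ _ _ _ (T _)).
    { intros k. replace (2 + k)%nat with (k + 2)%nat by lia. reflexivity. }
    match goal with |- is_series _ ?x => replace x with (f z) end; [exact (P z Hz)|].
    simpl. rewrite sum_Sn, sum_O.
    change (@eq C (f z) (f z - z + (0 * 1 + 1 / 1 * (z * 1)))). field.
  (* Since [a2 = 0], the determinant is [- a3^2] with [a3 = (1/2) / 3], whatever [a4] is. *)
  - assert (C1 : gauss_coef 1 1 = 0%R) by (unfold gauss_coef; simpl; field).
    assert (C2 : gauss_coef 1 2 = (1 / 2)%R) by (unfold gauss_coef; simpl; field).
    unfold hankel_2_2, extremal_coef. rewrite C1, C2.
    replace (RtoC 0 / RtoC (INR 2)) with (RtoC 0) by (unfold Cdiv; ring).
    rewrite <- !RtoC_div by (apply not_0_INR; lia).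
    replace (1 / 2 / INR 3)%R with (1 / 6)%R by (simpl; field).
    match goal with |- Cmod ?e = _ => replace e with (RtoC (- (1 / 36))) end.
    + rewrite Cmod_R, Rabs_Ropp, Rabs_pos_eq; lra.
    + rewrite Cmult_0_l, <- RtoC_pow, RtoC_opp.
      replace (1 / 36)%R with ((1 / 6) ^ 2)%R by field. ring.
Qed.

Theorem theorem3p1 :
  (forall (f : C -> C) (a : nat -> C),
      class_C phi f -> has_expansion f a ->
      (Cmod (hankel_2_2 a) <= 1 / 36)%R)
  /\
  (exists (f : C -> C) (a : nat -> C),
      class_C phi f /\ has_expansion f a /\
      Cmod (hankel_2_2 a) = (1 / 36)%R).
Proof.
  split; [|exact extremal_exists].
  intros f a [_ [N [omega [O1 [O2 [O3 O4]]]]]] E.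
  exact (hankel_bound f omega a E N O1 O2 O3 O4).
Qed.
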